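(* Let $R$ be a Cohen-Macaulay ring which is either a Noetherian local ring or a standard graded $K$-algebra ($K$ a field), and suppose that $R$ admits a canonical module $\omega_R$. Let $M$ be a finitely generated $R$-module (graded, if $R$ is graded) with a pretty clean filtration $\mathcal{F}$ such that $R/P$ is Cohen-Macaulay for all $P\in \operatorname{Supp}(\mathcal{F})$. Then $M$ is sequentially Cohen-Macaulay. Moreover, if $\dim R/P=\dim M$ for all $P\in\operatorname{Supp}(\mathcal{F})$, then $M$ is clean and Cohen-Macaulay.
   Context: Let $R$ be a Noetherian ring and $M$ a finitely generated $R$-module. A prime filtration of $M$ is a finite filtration $\mathcal{F}: 0=M_0\subset M_1\subset\cdots\subset M_r=M$ by submodules with $M_i/M_{i-1}\cong R/P_i$, $P_i$ a prime ideal, for $i=1,\dots,r$; set $\operatorname{Supp}(\mathcal{F})=\{P_1,\dots,P_r\}$. The filtration $\mathcal{F}$ is clean if $\operatorname{Supp}(\mathcal{F})\subset \operatorname{Min}(M)$ (the set of minimal primes of $\operatorname{Supp}(M)$), and pretty clean if for all $i<j$ with $P_i\subset P_j$ one has $P_i=P_j$. $M$ is called clean (pretty clean) if it admits a clean (pretty clean) filtration. For $R$ local or standard graded, a finitely generated (graded) module $M$ is sequentially Cohen-Macaulay if there is a finite filtration $0=N_0\subset N_1\subset\cdots\subset N_s=M$ by (graded) submodules such that each $N_i/N_{i-1}$ is Cohen-Macaulay and $\dim(N_1/N_0)<\dim(N_2/N_1)<\cdots<\dim(N_s/N_{s-1})$. *)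

(* Defs.v *)
From HB Require Import structures.
From mathcomp Require Import all_boot all_order all_algebra.
From mathcomp Require Import all_classical constructive_ereal.

Set Implicit Arguments.
Unset Strict Implicit.
Unset Printing Implicit Defensive.

Import Order.TTheory GRing.Theory Num.Theory.
Local Open Scope ring_scope.
Local Open Scope quotient_scope.

Notation ideal R := (submodClosed R^o).

Section SubmoduleType.
Variables (R : pzRingType) (V : lmodType R) (N : submodClosed V).

(* [submodClosed] is stated over semirings and does not inherit from
   [zmodClosed], which the library quotients require; this copy of N does. *)
Definition submod_pred : {pred V} := N.

HB.instance Definition _ :=
  GRing.isSubmodClosed.Build R V submod_pred (submodClosedP N).

Record sub_of := SubOf { sub_val : V; sub_valP : sub_val \in submod_pred }.

HB.instance Definition _ := [isSub for sub_val].
HB.instance Definition _ := [Choice of sub_of by <:].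
HB.instance Definition _ := [SubChoice_isSubLmodule of sub_of by <:].
End SubmoduleType.

(* The library quotient [Quotient.quot N] of the abelian group V, with its
   induced scaling. *)
Section QuotientModule.
Variables (R : pzRingType) (V : lmodType R) (N : submodClosed V).

Definition quotmod := Quotient.quot (submod_pred N).
HB.instance Definition _ := GRing.Zmodule.on quotmod.

Definition quot_pi (x : V) : quotmod := \pi_(Quotient.quot (submod_pred N)) x.

Definition quot_scale (a : R) (q : quotmod) : quotmod :=
  quot_pi (a *: repr (q : Quotient.quot (submod_pred N))).

Lemma quot_piP (q : quotmod) : exists x, q = quot_pi x.
Proof.
by exists (repr (q : Quotient.quot (submod_pred N))); rewrite /quot_pi reprK.
Qed.

Lemma quot_piD x y : quot_pi (x + y) = quot_pi x + quot_pi y.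
Proof. exact: (raddfD \pi_(Quotient.quot (submod_pred N))). Qed.

Lemma quot_piZ a x : quot_scale a (quot_pi x) = quot_pi (a *: x).
Proof.
rewrite /quot_scale; apply/eqP; rewrite -Quotient.idealrBE -scalerBr.
by apply: rpredZ; rewrite Quotient.idealrBE reprK.
Qed.

Lemma quot_scaleA a b v : quot_scale a (quot_scale b v) = quot_scale (a * b) v.
Proof. by have [x ->] := quot_piP v; rewrite !quot_piZ scalerA. Qed.

Lemma quot_scale1 : left_id 1 quot_scale.
Proof. by move=> v; have [x ->] := quot_piP v; rewrite quot_piZ scale1r. Qed.

Lemma quot_scaleDr : right_distributive quot_scale +%R.
Proof.
move=> a u v; have [x ->] := quot_piP u; have [y ->] := quot_piP v.
by rewrite -quot_piD !quot_piZ scalerDr quot_piD.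
Qed.

Lemma quot_scaleDl v : {morph quot_scale^~ v : a b / a + b}.
Proof.
by move=> a b; have [x ->] := quot_piP v; rewrite !quot_piZ scalerDl quot_piD.
Qed.

HB.instance Definition _ := GRing.Zmodule_isLmodule.Build R quotmod
  quot_scaleA quot_scale1 quot_scaleDr quot_scaleDl.
End QuotientModule.

Section Subquotient.
Variables (R : pzRingType) (V : lmodType R) (A B : submodClosed V).

Definition trace_pred : {pred sub_of A} := [pred x | sub_val x \in B].

Lemma trace_closed : submod_closed trace_pred.
Proof.
split=> [|a x y xB yB]; first exact: rpred0.
by rewrite inE /= rpredD // rpredZ.
Qed.

HB.instance Definition _ :=
  GRing.isSubmodClosed.Build R (sub_of A) trace_pred trace_closed.

(* A / (A :&: B), that is A / B in case B is included in A. *)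
Definition subquot : lmodType R := quotmod trace_pred.
End Subquotient.

Section SmulImage.
Variables (R : comPzRingType) (V : lmodType R) (x : R).

Definition smul_pred : {pred V} := [pred z | `[< exists y : V, z = x *: y >]].

Lemma smul_closed : submod_closed smul_pred.
Proof.
split=> [|a _ _ /asboolP[u ->] /asboolP[v ->]]; apply/asboolP.
  by exists 0; rewrite scaler0.
by exists (a *: u + v); rewrite scalerDr !scalerA mulrC.
Qed.

HB.instance Definition _ :=
  GRing.isSubmodClosed.Build R V smul_pred smul_closed.
End SmulImage.

Section CommutativeAlgebra.
Variable R : comNzRingType.
Implicit Types (I P Q m : ideal R) (V W M C : lmodType R).

Definition lin_iso V W := exists f : {linear V -> W}, bijective f.

Definition nonzero V := exists x : V, x != 0.

Definition fin_gen V := exists (n : nat) (g : 'I_n -> V),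
  forall x, exists c : 'I_n -> R, x = \sum_i c i *: g i.

Definition noetherian := forall I, fin_gen (sub_of I).

Definition is_prime P :=
  1 \notin P /\ prime_idealr_closed (P : {pred R}).

Definition is_maximal m := 1 \notin m /\
  forall I, 1 \notin I -> {subset m <= I} -> {subset I <= m}.

Definition is_local m := is_maximal m /\ forall n, is_maximal n -> n =i m.

(* M_P <> 0: some x / 1 is nonzero in the localization, that is, x is killed
   by no element outside P. *)
Definition supp M P :=
  is_prime P /\ exists x : M, forall s : R, s \notin P -> s *: x != 0.

Definition min_supp M P :=
  supp M P /\ forall Q, supp M Q -> {subset Q <= P} -> Q =i P.

Definition is_max_of (A : set nat) (n : nat) :=
  A n /\ forall k, A k -> (k <= n)%N.

(* Supremum in the extended integers, with value -oo for the empty set. *)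
Definition sup_nat (A : set nat) : \bar int :=
  if `[< A = set0 >] then -oo%E
  else if `[< exists n, is_max_of A n >] then (xget 0%N (is_max_of A))%:Z%:E
  else +oo%E.

Definition supp_chain M (n : nat) := exists P : nat -> ideal R,
  (forall i, (i <= n)%N -> supp M (P i)) /\
  (forall i, (i < n)%N ->
     {subset P i <= P i.+1} /\ ~ {subset P i.+1 <= P i}).

Definition krull_dim M : \bar int := sup_nat (supp_chain M).

Fixpoint regular_seq (xs : seq R) (M : lmodType R) : Prop :=
  if xs is x :: xs' then
    (forall y : M, x *: y = 0 -> y = 0) /\
    regular_seq xs' (quotmod (@smul_pred R M x))
  else nonzero M.

Definition depth m M : \bar int := sup_nat
  [set n | exists xs : seq R,
     [/\ size xs = n, (forall x, x \in xs -> x \in m) & regular_seq xs M]].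

(* The zero module has depth and dimension -oo, hence is Cohen-Macaulay. *)
Definition CM m M := depth m M = krull_dim M.

Definition filtration M (r : nat) (F : nat -> submodClosed M) :=
  [/\ forall x, (x \in F 0%N) = (x == 0), forall x, x \in F r
    & forall i, (i < r)%N -> {subset F i <= F i.+1}].

(* P i stands for the prime of the step from F i to F i.+1. *)
Definition prime_filtration M (r : nat) (F : nat -> submodClosed M)
    (P : nat -> ideal R) :=
  filtration r F /\
  forall i, (i < r)%N ->
    is_prime (P i) /\ lin_iso (subquot (F i.+1) (F i)) (quotmod (P i)).

Definition clean_filtration M r (F : nat -> submodClosed M) (P : nat -> ideal R) :=
  prime_filtration r F P /\ forall i, (i < r)%N -> min_supp M (P i).

Definition pretty_clean_filtration M r (F : nat -> submodClosed M)
    (P : nat -> ideal R) :=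
  prime_filtration r F P /\
  forall i j, (i < j)%N -> (j < r)%N -> {subset P i <= P j} -> P i =i P j.

Definition clean M := exists r (F : nat -> submodClosed M) (P : nat -> ideal R),
  clean_filtration r F P.

(* [adm] restricts the submodules allowed in the filtration. *)
Definition seq_CM_among m M (adm : submodClosed M -> Prop) :=
  exists (s : nat) (N : nat -> submodClosed M),
  [/\ filtration s N,
      forall i, (i <= s)%N -> adm (N i),
      forall i, (i < s)%N -> CM m (subquot (N i.+1) (N i))
    & forall i, (i.+1 < s)%N ->
        (krull_dim (subquot (N i.+1) (N i)) <
         krull_dim (subquot (N i.+2) (N i.+1)))%E].

Definition seq_CM m M := seq_CM_among m (fun _ : submodClosed M => True).

Definition projective_mod V := forall (A B : lmodType R)
    (g : {linear A -> B}) (f : {linear V -> B}),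
  (forall b, exists a, g a = b) ->
  exists h : {linear V -> A}, forall v, g (h v) = f v.

Definition injective_mod V := forall (A B : lmodType R)
    (g : {linear A -> B}) (f : {linear A -> V}),
  injective g -> exists h : {linear B -> V}, forall a, h (g a) = f a.

Record proj_resolution V := ProjResolution {
  pr_obj : nat -> lmodType R;
  pr_diff : forall i, {linear pr_obj i.+1 -> pr_obj i};
  pr_aug : {linear pr_obj 0%N -> V};
  pr_proj : forall i, projective_mod (pr_obj i);
  pr_aug_surj : forall v, exists x, pr_aug x = v;
  pr_exact0 : forall x, pr_aug x = 0 <-> exists y, x = pr_diff 0 y;
  pr_exactS : forall i x,
    pr_diff i x = 0 <-> exists y, x = pr_diff i.+1 y }.

Section Ext.
Variables (V : lmodType R) (F : proj_resolution V) (C : lmodType R).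

(* Cocycles and coboundaries of Hom(F, C) in degree i, inside the module of
   all functions from the i-th term of F to C. *)
Definition cocycle (i : nat) : {pred pr_obj F i -> C} :=
  [pred f | `[< linear f /\ forall y, f (pr_diff F i y) = 0 >]].

Definition coboundary (i : nat) : {pred pr_obj F i -> C} :=
  match i return {pred pr_obj F i -> C} with
  | 0 => [pred f | f == 0]
  | j.+1 => [pred f | `[< exists h : {linear pr_obj F j -> C},
                            f = h \o pr_diff F j >]]
  end.

Arguments cocycle : clear implicits.
Arguments coboundary : clear implicits.

Lemma cocycle_closed i : submod_closed (cocycle i).
Proof.
split=> [|a f g /asboolP[lf f0] /asboolP[lg g0]]; apply/asboolP.
  by split=> // b x y /=; rewrite scaler0 addr0.
have E z : (a *: f + g) z = a *: f z + g z by [].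
split=> [b x y|y]; rewrite !E; last by rewrite f0 g0 scaler0 addr0.
by rewrite lf lg !scalerDr !scalerA (mulrC b) addrACA.
Qed.

Lemma coboundary_closed i : submod_closed (coboundary i).
Proof.
case: i => [|j].
  split=> [|a f g]; first by rewrite inE.
  move=> /eqP-> /eqP->; apply/eqP; exact: etrans (addr0 _) (scaler0 _ _).
split=> [|a f g].
  by apply/asboolP; exists \0; apply/funext.
move=> /asboolP[h ->] /asboolP[k ->]; apply/asboolP.
by exists (a \*: h \+ k); apply/funext.
Qed.

HB.instance Definition _ i := GRing.isSubmodClosed.Build R
  (pr_obj F i -> C) (cocycle i) (cocycle_closed i).
HB.instance Definition _ i := GRing.isSubmodClosed.Build R
  (pr_obj F i -> C) (coboundary i) (coboundary_closed i).

(* Ext^i_R(V, C), computed from the projective resolution F of V. *)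
Definition Ext (i : nat) : lmodType R := subquot (cocycle i) (coboundary i).
End Ext.

Definition finite_injdim C :=
  exists (n : nat) (E : nat -> lmodType R) (e : {linear C -> E 0%N})
         (d : forall i, {linear E i -> E i.+1}),
  [/\ forall i, injective_mod (E i), injective e,
      forall y, d 0%N y = 0 <-> exists x, y = e x,
      forall i y, d i.+1 y = 0 <-> exists x, y = d i x
    & forall i, (n < i)%N -> ~ nonzero (E i)].

(* dim_k Ext^t(k, C) = 1 for k = R / m and t = depth C. *)
Definition type1 m C := exists (F : proj_resolution (quotmod m)) (t : nat),
  depth m C = t%:Z%:E /\ lin_iso (Ext F C t) (quotmod m).

(* Canonical modules over a Cohen-Macaulay local ring: maximal Cohen-Macaulay,
   of type 1 and of finite injective dimension (Bruns-Herzog, 3.3.1). *)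
Definition is_canonical m C :=
  [/\ fin_gen C, CM m C /\ krull_dim C = krull_dim R^o, type1 m C
    & finite_injdim C].

End CommutativeAlgebra.

(* V is the internal direct sum of the G i. *)
Definition direct_sum (I : eqType) (V : zmodType) (G : I -> {pred V}) :=
  (forall x : V, exists (s : seq I) (c : I -> V),
     [/\ uniq s, forall i, c i \in G i & x = \sum_(i <- s) c i]) /\
  (forall (s : seq I) (c : I -> V), uniq s -> (forall i, c i \in G i) ->
     \sum_(i <- s) c i = 0 -> forall i, i \in s -> c i = 0).

Section Graded.
Variables (K : fieldType) (R : comAlgType K).
Implicit Type G : nat -> submodClosed (R : lmodType K).

Definition standard_graded G :=
  [/\ direct_sum (fun i => G i : {pred R}),
      forall i j (x y : R), x \in G i -> y \in G j -> x * y \in G (i + j)%N,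
      forall x : R, x \in G 0%N <-> exists a : K, x = a%:A,
      exists (n : nat) (b : 'I_n -> R), (forall i, b i \in G 1%N) /\
        forall x, x \in G 1%N -> exists c : 'I_n -> K, x = \sum_i c i *: b i
    & forall S : subalgClosed R, {subset G 1%N <= S} -> forall x : R, x \in S].

(* m is the direct sum of the G i for i > 0. *)
Definition is_irrelevant G (m : ideal R) := forall x : R,
  x \in m <-> exists (s : seq nat) (c : nat -> R),
    [/\ 0%N \notin s, uniq s, forall i, c i \in G i & x = \sum_(i <- s) c i].

Definition graded_module G (M : lmodType R) (MG : int -> zmodClosed M) :=
  direct_sum (fun i => MG i : {pred M}) /\
  forall (i : nat) (j : int) (a : R) (v : M),
    a \in G i -> v \in MG j -> a *: v \in MG (i%:Z + j).

Definition homogeneous (M : lmodType R) (MG : int -> zmodClosed M)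
    (N : submodClosed M) :=
  forall (s : seq int) (c : int -> M), uniq s -> (forall i, c i \in MG i) ->
    \sum_(i <- s) c i \in N -> forall i, i \in s -> c i \in N.

Definition graded_seq_CM (m : ideal R) (M : lmodType R)
    (MG : int -> zmodClosed M) := seq_CM_among m (homogeneous MG).

(* Canonical modules over a standard graded Cohen-Macaulay algebra: with
   k = R / m and d = dim R, Ext^d(k, C) = k and Ext^i(k, C) = 0 for i <> d
   (Bruns-Herzog, 3.6.8).  Degrees are not recorded in Ext^d(k, C) = k: as k is
   one-dimensional, they only affect C by a shift. *)
Definition is_graded_canonical G (m : ideal R) (C : lmodType R)
    (CG : int -> zmodClosed C) :=
  [/\ fin_gen C, graded_module G CG
    & exists F : proj_resolution (quotmod m), forall i : nat,
        if i%:Z%:E == krull_dim R^o then lin_iso (Ext F C i) (quotmod m)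
        else ~ nonzero (Ext F C i)].

End Graded.

(* Main.v *)
Require Import Defs.
From HB Require Import structures.
From mathcomp Require Import all_boot all_order all_algebra.
From mathcomp Require Import all_classical constructive_ereal.
From mathcomp Require Import ring.

Set Implicit Arguments.
Unset Strict Implicit.
Unset Printing Implicit Defensive.

Import Order.TTheory GRing.Theory Num.Theory.
Local Open Scope ring_scope.

(* The heart of the matter is a splitting lemma: an extension
   0 -> R/P -> E -> R/Q -> 0 with R/P and R/Q Cohen-Macaulay, dim R/P > dim R/Q
   and P not contained in Q, splits.  Indeed, take s in P \ Q.  If e lifts the
   generator of R/Q, it suffices to split the extension modulo R s e, that is,
   to extend to R a linear map J -> R/P, where J = Q + (s).  Now
   dim R/J <= depth R/P - 2, so J contains an (R/P)-regular sequence of length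
   two, and then every such map is a multiplication.

   Consequently two adjacent steps of a pretty clean filtration that are in the
   wrong order for the dimension can be exchanged, and the filtration can be
   sorted by increasing dimension.  The steps of equal dimension d are then
   grouped; a group has dimension d, and its depth is at least d because depth
   is bounded below along extensions.  The submodule reached after the first
   groups is the set of elements killed by the product of the primes used so
   far; in the graded case these primes are annihilators of elements, hence
   graded, and so are these submodules. *)

(** The inequality behind the splitting is depth B/A <= dim R/ann(u), for every u in B/A whose
    annihilator lies in m. Thus an ideal J that kills a nonzero element of R/P or of R/(P + (x))
    bounds a depth by dim R/J. The gap dim R/Q < dim R/P gives one regular element, and since s is
    outside Q, passing from Q to J lowers the dimension once more and gives the second. If y in J is
    regular modulo P + (x), a linear map f on J satisfies y f(x) = x f(y), so f(x) = a x for some a,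
    and f is multiplication by a because x is regular modulo P. Localizations are replaced by
    multipliers outside m. Dimensions are compared as sets of chain lengths and depths by the
    existence of sequences; numerical suprema enter only when the definitions are matched. The local
    and the graded case share one argument through [local_class]: in the graded case the elements
    whose annihilator must lie in m have to be chosen homogeneous. *)

(** * Linear combinations in modules, by reflection *)

Section ModuleExpressions.
Variables (R : comNzRingType) (V : lmodType R).

Inductive mexpr :=
  | MZero | MVar of nat | MAdd of mexpr & mexpr | MOpp of mexpr
  | MScale of R & mexpr.

Fixpoint meval (vs : seq V) e : V := match e with
  | MZero => 0 | MVar n => nth 0 vs n | MAdd e f => meval vs e + meval vs f
  | MOpp e => - meval vs e | MScale a e => a *: meval vs e end.

(** The test uses [eqn], which reduces on numerals, so that [cbn] leaves identities in [R] that
    [ring] can decide. *)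
Fixpoint mcoef e (n : nat) : R := match e with
  | MZero => 0 | MVar k => if eqn k n then 1 else 0
  | MAdd e f => mcoef e n + mcoef f n
  | MOpp e => - mcoef e n | MScale a e => a * mcoef e n end.

Fixpoint mclosed (k : nat) e : bool := match e with
  | MZero => true | MVar n => (n < k)%N | MAdd e f => mclosed k e && mclosed k f
  | MOpp e => mclosed k e | MScale a e => mclosed k e end.

Lemma eqn_eq m n : eqn m n = (m == n). Proof. by []. Qed.

Lemma meval_coef vs e : mclosed (size vs) e ->
  meval vs e = \sum_(i < size vs) mcoef e i *: nth 0 vs i.
Proof.
elim: e => [|k|e IHe f IHf|e IHe|a e IHe] /=.
- by move=> _; rewrite big1 // => i _; rewrite scale0r.
- move=> kv; rewrite (bigD1 (Ordinal kv)) //= eqn_eq eqxx scale1r big1 ?addr0 //.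
  by move=> i; rewrite -val_eqE /= eqn_eq eq_sym => /negbTE ->; rewrite scale0r.
- move=> /andP[/IHe -> /IHf ->]; rewrite -big_split /=.
  by apply: eq_bigr => i _; rewrite scalerDl.
- by move=> /IHe ->; rewrite -sumrN; apply: eq_bigr => i _; rewrite scaleNr.
- by move=> /IHe ->; rewrite scaler_sumr; apply: eq_bigr => i _; rewrite scalerA.
Qed.

(** Unfolds to a finite conjunction, one ring identity for each atom. *)
Fixpoint all_below (n : nat) (P : nat -> Prop) : Prop :=
  if n is k.+1 then P k /\ all_below k P else True.

Lemma meval_eq vs e f : mclosed (size vs) e && mclosed (size vs) f ->
  all_below (size vs) (fun i => mcoef e i = mcoef f i) ->
  meval vs e = meval vs f.
Proof.
move=> /andP[ce cf] H; rewrite !meval_coef //; apply: eq_bigr => i _.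
congr (_ *: _); case: i => i /=.
elim: (size vs) H => // n IH /= [Hn Hr]; rewrite ltnS leq_eqVlt.
by case/orP => [/eqP -> // | /IH]; apply.
Qed.
End ModuleExpressions.

Ltac mindex x vs :=
  lazymatch vs with
  | x :: _ => constr:(0%N)
  | _ :: ?vs' => let n := mindex x vs' in constr:(n.+1)
  end.
Ltac mcollect e vs :=
  lazymatch e with
  | (?x + ?y)%R => let vs := mcollect x vs in mcollect y vs
  | (- ?x)%R => mcollect x vs
  | (_ *: ?x)%R => mcollect x vs
  | 0%R => vs
  | ?x => match vs with
          | _ => let _ := mindex x vs in vs
          | _ => constr:(x :: vs)
          end
  end.
Ltac mreify R e vs :=
  lazymatch e with
  | (?x + ?y)%R => let a := mreify R x vs in let b := mreify R y vs in
                   constr:(@MAdd R a b)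
  | (- ?x)%R => let a := mreify R x vs in constr:(@MOpp R a)
  | (?r *: ?x)%R => let a := mreify R x vs in constr:(@MScale R r a)
  | 0%R => constr:(@MZero R)
  | ?x => let n := mindex x vs in constr:(@MVar R n)
  end.
(* Decides equalities of linear combinations by comparing coefficients. *)
Ltac mring :=
  lazymatch goal with
  | |- @eq ?T ?x ?y =>
    let R := lazymatch goal with
      | |- context [@GRing.scale ?R _ _ _] => constr:(R) end in
    let vs := mcollect x (@nil T) in
    let vs := mcollect y vs in
    let a := mreify R x vs in
    let b := mreify R y vs in
    apply: (@meval_eq _ _ vs a b); [reflexivity | cbn; repeat split; ring]
  end.

(** * Submodules, spans and ideals *)

Section Submodules.
Variables (R : comNzRingType) (V : lmodType R).
Implicit Types (A B C U : V -> Prop) (es : seq V).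

(** Submodules are plain predicates on a fixed module: passing to a further quotient then changes a
    denominator and never a type. *)
Definition subm A := A 0 /\ forall a x y, A x -> A y -> A (a *: x + y).

Definition sub (T : Type) (A B : T -> Prop) := forall x, A x -> B x.

Lemma sub_eq (T : Type) (A B : T -> Prop) : sub A B -> sub B A -> A = B.
Proof. by move=> AB BA; apply/funext => x; apply/propext; split; auto. Qed.

Definition zerom : V -> Prop := fun v => v = 0.
Definition fullm : V -> Prop := fun _ => True.

Lemma zerom_subm : subm zerom.
Proof. by split=> // a x y -> ->; rewrite /zerom scaler0 addr0. Qed.

Lemma fullm_subm : subm fullm. Proof. by []. Qed.

Section Closure.
Variable A : V -> Prop.
Hypothesis sA : subm A.

Lemma subm0 : A 0. Proof. by case: sA. Qed.

Lemma submP a x y : A x -> A y -> A (a *: x + y).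
Proof. by case: sA => _; apply. Qed.

Lemma submD x y : A x -> A y -> A (x + y).
Proof. by move=> Ax Ay; rewrite -[x]scale1r; apply: submP. Qed.

Lemma submZ a x : A x -> A (a *: x).
Proof. by move=> Ax; rewrite -[_ *: _]addr0; apply/submP/subm0. Qed.

Lemma submN x : A x -> A (- x).
Proof. by rewrite -scaleN1r; apply: submZ. Qed.

Lemma submB x y : A x -> A y -> A (x - y).
Proof. by move=> Ax /submN; apply: submD. Qed.

Lemma subm_sum (I : eqType) (s : seq I) (F : I -> V) :
  (forall i, i \in s -> A (F i)) -> A (\sum_(i <- s) F i).
Proof.
move=> AF; rewrite big_seq; elim/big_ind: _ => //; first exact: subm0.
exact: submD.
Qed.

Lemma submDl x y : A x -> A (x + y) <-> A y.
Proof.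
move=> Ax; split; last exact: submD.
by move=> Axy; rewrite -[y](addKr x); apply: submD Axy; apply: submN.
Qed.
End Closure.

(** The sum of [A] and the span of [es]. For a singleton [es] it unfolds to one existential, the
    form of a single step of a prime filtration. *)
Definition spanm A es :=
  foldr (fun e U v => exists r u, U u /\ v = u + r *: e) A es.

Lemma spanm_subm A es : subm A -> subm (spanm A es).
Proof.
move=> sA; elim: es => //= e es IH; split.
  by exists 0, 0; split; [exact: subm0|rewrite scale0r addr0].
move=> a _ _ [r [u [Uu ->]]] [r' [u' [Uu' ->]]].
exists (a * r + r'), (a *: u + u'); split; first exact: submP.
by mring.
Qed.

Lemma sub_spanm A es : sub A (spanm A es).
Proof.
move=> v Av; elim: es => //= e es IH.
by exists 0, v; rewrite scale0r addr0.
Qed.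

Lemma spanm_mem A es e : subm A -> e \in es -> spanm A es e.
Proof.
move=> sA; elim: es => //= f es IH; rewrite inE => /orP[/eqP ->|/IH H].
  exists 1, 0; split; last by rewrite scale1r add0r.
  exact: subm0 (spanm_subm es sA).
by exists 0, e; rewrite scale0r addr0.
Qed.

Lemma spanm_min A U es : subm U -> sub A U -> (forall e, e \in es -> U e) ->
  sub (spanm A es) U.
Proof.
move=> sU AU; elim: es => //= e es IH esU _ [r [u [Uu ->]]].
apply: submD => //; last by apply: (submZ sU); apply: esU; rewrite mem_head.
by apply: IH => // f fe; apply: esU; rewrite inE fe orbT.
Qed.

Lemma spanm_split A es v : subm A -> spanm A es v ->
  exists w, spanm zerom es w /\ A (v - w).
Proof.
move=> sA; elim: es v => /= [|e es IH] v.
  by move=> Av; exists 0; rewrite subr0.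
move=> [r [u [/IH[w [zw Auw]] ->]]]; exists (w + r *: e); split.
  by exists r, w.
by rewrite opprD addrACA subrr addr0.
Qed.

(* A pair B, A of subsets of V stands for the quotient B / A. *)
Definition noethp B A := forall U, subm U -> sub U B ->
  exists es, (forall e, e \in es -> U e) /\ sub U (spanm A es).

Lemma noethp_trans C B A : subm A -> subm B ->
  noethp C B -> noethp B A -> noethp C A.
Proof.
move=> sA sB nCB nBA U sU UC.
have [es2 [es2U Us2]] := nCB U sU UC.
have [|v []//|es1 [es1U Us1]] := nBA (fun v => U v /\ B v).
  split; first by split; apply: subm0.
  by move=> a x y [Ux Bx] [Uy By]; split; apply: submP.
exists (es1 ++ es2); split.
  by move=> e; rewrite mem_cat => /orP[/es1U[]|/es2U].
have sS := spanm_subm (es1 ++ es2) sA.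
(* Subtracting the combination [w] of [es2] brings [v] into the intersection of [U] and [B], which
   [es1] generates modulo [A]. *)
move=> v Uv; have [w [zw Bvw]] := spanm_split sB (Us2 v Uv).
have Uw : U w.
  by apply: spanm_min zw => // [_ ->]; apply: subm0.
rewrite -[v](subrK w); apply: submD => //.
  have : spanm A es1 (v - w) by apply: Us1; split=> //; apply: submB.
  apply: spanm_min => //; first exact: sub_spanm.
  by move=> e ee; apply: spanm_mem => //; rewrite mem_cat ee.
apply: spanm_min zw => // [_ ->|e ee]; first exact: subm0.
by apply: spanm_mem => //; rewrite mem_cat ee orbT.
Qed.

Lemma noethp_refl A : noethp A A.
Proof. by move=> U _ UA; exists [::]. Qed.
End Submodules.
Arguments zerom {R V}.
Arguments fullm {R V}.

Section Ideals.
Variable R : comNzRingType.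
Implicit Types I J p : R -> Prop.

Definition is_ideal I := I 0 /\ forall a x y, I x -> I y -> I (a * x + y).

Section Closure.
Variable I : R -> Prop.
Hypothesis iI : is_ideal I.

Lemma ideal0 : I 0. Proof. by case: iI. Qed.

Lemma idealD x y : I x -> I y -> I (x + y).
Proof. by case: iI => _ H Ix Iy; rewrite -[x]mul1r; apply: H. Qed.

Lemma idealM r x : I x -> I (r * x).
Proof. by case: iI => I0 H Ix; rewrite -[_ * _]addr0; apply: H. Qed.

Lemma idealMr r x : I x -> I (x * r).
Proof. by rewrite mulrC; apply: idealM. Qed.

Lemma idealN x : I x -> I (- x).
Proof. by rewrite -mulN1r; apply: idealM. Qed.

Lemma idealB x y : I x -> I y -> I (x - y).
Proof. by move=> Ix /idealN; apply: idealD. Qed.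

Lemma idealDl x y : I x -> I (x + y) <-> I y.
Proof.
move=> Ix; split; last exact: idealD.
by move=> Ixy; rewrite -[y](addKr x); apply: idealD Ixy; apply: idealN.
Qed.

Lemma ideal_sum (T : eqType) (s : seq T) (F : T -> R) :
  (forall i, i \in s -> I (F i)) -> I (\sum_(i <- s) F i).
Proof. exact: (@subm_sum R R^o). Qed.
End Closure.

Definition noethR := noethp (@fullm R R^o) zerom.

Lemma noethp_ideal I : noethR -> is_ideal I -> @noethp R R^o fullm I.
Proof.
move=> nR sI U sU Uf; have [es [esU Ues]] := nR U sU Uf.
exists es; split=> // v /Ues; apply: spanm_min; first exact: spanm_subm.
  by move=> _ ->; apply: subm0 (spanm_subm es sI).
by move=> e; apply: spanm_mem.
Qed.

(** Otherwise choice produces a strictly increasing sequence of ideals; its union is finitely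
    generated, hence equal to one of its terms. *)
Lemma noeth_max (C : (R -> Prop) -> Prop) I0 : noethR -> C I0 ->
  (forall I, C I -> is_ideal I) ->
  exists I, C I /\ forall J, C J -> sub I J -> sub J I.
Proof.
move=> nR CI0 Csub; apply: contrapT => nomax.
have step (I : {I | C I}) : exists J : {J | C J},
    sub (sval I) (sval J) /\ ~ sub (sval J) (sval I).
  apply: contrapT => H; apply: nomax; exists (sval I); split; first exact: svalP.
  move=> J CJ IJ; apply: contrapT => JI; apply: H.
  by exists (exist _ J CJ).
have [f Hf] := choice step.
pose s n := sval (iter n f (exist _ I0 CI0)).
have sS n : sub (s n) (s n.+1).
  by rewrite /s iterS; have [] := Hf (iter n f (exist _ I0 CI0)).
have smono m n : (m <= n)%N -> sub (s m) (s n).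
  move=> /subnKC <-; elim: (n - m)%N => [|k IH]; first by rewrite addn0.
  by rewrite addnS => x /IH /sS.
have ss n : is_ideal (s n) by apply: Csub; apply: svalP.
pose U (x : R) := exists n, s n x.
have sU : @subm R R^o U.
  split; first by exists 0%N; apply: ideal0.
  move=> a x y [m sx] [n sy]; exists (maxn m n); apply: (@submP R R^o _ (ss _)).
    by apply: smono sx; rewrite leq_maxl.
  by apply: smono sy; rewrite leq_maxr.
have [es [esU Ues]] := nR U sU (fun _ _ => I).
have [n Hn] : exists n, forall e, e \in es -> s n e.
  elim: es esU {Ues} => [|e es IH] esU; first by exists 0%N.
  have [|n Hn] := IH; first by move=> f' fe; apply: esU; rewrite inE fe orbT.
  have [k ke] := esU e (mem_head _ _).
  exists (maxn n k) => f'; rewrite inE => /orP[/eqP ->|/Hn].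
    by apply: smono ke; rewrite leq_maxr.
  by apply: smono; rewrite leq_maxl.
have [] := Hf (iter n f (exist _ I0 CI0)); rewrite -iterS -/(s _) -/(s _) => _.
apply=> x sx; have /Ues : U x by exists n.+1.
apply: (@spanm_min R R^o _ _ _ (ss n)) => // _ ->; exact: ideal0.
Qed.

Definition primes p :=
  [/\ is_ideal p, ~ p 1 & forall a b : R, p (a * b) -> p a \/ p b].

Lemma primeN p (a b : R) : primes p -> ~ p a -> ~ p b -> ~ p (a * b).
Proof. by case=> _ _ pp na nb /pp[]. Qed.

(** Convertible to [spanm I [:: c]] in [R^o], so facts on spans apply directly. *)
Definition add_gen I c : R -> Prop := fun v => exists r u, I u /\ v = u + r * c.

Lemma add_gen_ideal I c : is_ideal I -> is_ideal (add_gen I c).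
Proof. by move=> iI; apply: (@spanm_subm R R^o I [:: c] iI). Qed.

Lemma sub_add_gen I c : sub I (add_gen I c).
Proof. by move=> x Ix; exists 0, x; rewrite mul0r addr0. Qed.

Lemma add_gen_mem I c : is_ideal I -> add_gen I c c.
Proof. by move=> iI; exists 1, 0; rewrite mul1r add0r; split=> //; apply: ideal0. Qed.

(* An ideal maximal among those disjoint from a multiplicative set is prime. *)
Lemma prime_avoiding J (S : R -> Prop) : noethR -> is_ideal J -> S 1 ->
  (forall a b, S a -> S b -> S (a * b)) -> (forall x, J x -> ~ S x) ->
  exists p, [/\ primes p, sub J p & forall x, p x -> ~ S x].
Proof.
move=> nR sJ S1 SM JS.
have [|I []//|p [[sp Jp pS] pmax]] := @noeth_max
  (fun I => [/\ is_ideal I, sub J I & forall x, I x -> ~ S x]) J nR.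
  by split.
exists p; split=> //; split=> // [p1|a b pab]; first exact: pS p1 S1.
apply: contrapT => /not_orP[na nb].
have ext (c : R) : ~ p c -> exists r u, p u /\ S (u + r * c).
  move=> nc; apply: contrapT => H.
  apply: nc; apply: (pmax (add_gen p c)); last exact: add_gen_mem.
    split; first exact: add_gen_ideal.
      by move=> x /Jp; apply: sub_add_gen.
    by move=> x [r [u [pu ->]]] Sx; apply: H; exists r, u.
  exact: sub_add_gen.
have [r [u [pu Su]]] := ext a na; have [r' [u' [pu' Su']]] := ext b nb.
apply: pS (SM _ _ Su Su').
have -> : (u + r * a) * (u' + r' * b) =
  (u' + r' * b) * u + (r * a * u' + r * r' * (a * b)) by ring.
by do 2?apply: idealD => //; apply: idealM.
Qed.
End Ideals.

(** * Zero divisors and prime avoidance *)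

Section Annihilators.
Variables (R : comNzRingType) (V : lmodType R).
Hypothesis nR : noethR R.
Implicit Types (A B U : V -> Prop) (J p Z : R -> Prop).

Definition ann A (u : V) : R -> Prop := fun r => A (r *: u).

Lemma ann_ideal A u : subm A -> is_ideal (ann A u).
Proof.
move=> sA; split; first by rewrite /ann scale0r; apply: subm0.
move=> a x y; rewrite /ann => Ax Ay.
have -> : (a * x + y) *: u = a *: (x *: u) + y *: u by mring.
exact: submP.
Qed.

Definition maxann B A u := [/\ B u, ~ A u
  & forall w, B w -> ~ A w -> sub (ann A u) (ann A w) ->
      sub (ann A w) (ann A u)].

Lemma maxann_exists B A v : subm A -> B v -> ~ A v ->
  exists u, maxann B A u /\ sub (ann A v) (ann A u).
Proof.
move=> sA Bv nAv; pose C I := exists w,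
  [/\ B w, ~ A w, I = ann A w & sub (ann A v) I].
have [||_ [[u [Bu nAu -> vu]] umax]] := @noeth_max R C (ann A v) nR.
- by exists v; split.
- by move=> _ [w [_ _ -> _]]; apply: ann_ideal.
exists u; split=> //; split=> // w Bw nAw uw; apply: umax => //.
by exists w; split=> // x /vu /uw.
Qed.

(** If ab kills u modulo [A] and b does not, the annihilator of b u contains that of u, so by
    maximality they coincide, and a lies in it. *)
Lemma maxann_prime B A u : subm A -> subm B -> maxann B A u -> primes (ann A u).
Proof.
move=> sA sB [Bu nAu umax]; split; first exact: ann_ideal.
  by rewrite /ann scale1r.
move=> a b; rewrite /ann -scalerA => ab.
have [|nb] := pselect (A (b *: u)); first by right.
left; apply: (umax (b *: u)) => //; first exact: submZ.
by move=> r; rewrite /ann scalerA mulrC -scalerA => Ar; apply: submZ.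
Qed.

Definition zdiv B A : R -> Prop :=
  fun x => exists b, [/\ B b, ~ A b & A (x *: b)].

Definition avoidable J (Z : R -> Prop) := exists ps : seq (R -> Prop),
  (forall p, List.In p ps -> primes p /\ ~ sub J p) /\
  forall x, Z x -> exists p, List.In p ps /\ p x.

Lemma avoidableU J Z1 Z2 : avoidable J Z1 -> avoidable J Z2 ->
  avoidable J (fun x => Z1 x \/ Z2 x).
Proof.
move=> [p1 [H1 Z1p]] [p2 [H2 Z2p]]; exists (p1 ++ p2); split.
  by move=> p /(@List.in_app_or _ p1 p2)[/H1|/H2].
move=> x [/Z1p|/Z2p] [p [pi px]]; exists p; split=> //.
  by apply: (@List.in_or_app _ p1 p2); left.
by apply: (@List.in_or_app _ p1 p2); right.
Qed.

Lemma prime_avoidance J Z : is_ideal J -> avoidable J Z -> exists x, J x /\ ~ Z x.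
Proof.
move=> sJ [ps [Hps Zps]].
suff [x [Jx nx]] : exists x, J x /\ forall p, List.In p ps -> ~ p x.
  by exists x; split=> // /Zps[p [/nx]].
elim: ps Hps {Zps} => [|p ps IH] Hps; first by exists 0; split=> //; apply: ideal0.
have [|x [Jx nx]] := IH; first by move=> q qi; apply: Hps; right.
have [px|npx] := pselect (p x); last first.
  by exists x; split=> // q [<-//|/nx].
(* Here [x] is in [p]. It is corrected by some [y] in [J] outside [p] that lies in every other
   listed prime not contained in [p]: a product of elements, one for each prime. *)
have [pp npJ] := Hps p (or_introl erefl).
have [sp _ _] := pp.
have [y [Jy npy ypsi]] : exists y, [/\ J y, ~ p y &
    forall q, List.In q ps -> ~ sub q p -> q y].
  have {Hps nx IH} : forall q, List.In q ps -> is_ideal q.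
    by move=> q qi; have [|[]] := Hps q; first by right.
  elim: ps => [|q qs IH] Hq.
    by move/existsNP: npJ => [y /not_implyP[Jy npy]]; exists y.
  have [|y [Jy npy Hy]] := IH; first by move=> q' qi; apply: Hq; right.
  have sq : is_ideal q by apply: Hq; left.
  have [qp|nqp] := pselect (sub q p).
    by exists y; split=> // q' [<-//|]; apply: Hy.
  move/existsNP: (nqp) => [z /not_implyP[qz npz]].
  exists (y * z); split; first exact: idealMr.
    exact: primeN.
  move=> q' [<- _|qi nq']; first exact: idealM.
  by apply: idealMr; [apply: Hq; right|apply: Hy].
(* The sum avoids [p], hence all primes inside [p]; a remaining prime contains [y] but not [x]. *)
exists (x + y); split; first exact: idealD.
have npxy : ~ p (x + y) by rewrite idealDl.
move=> q [<-//|qi] qxy.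
have [qp|nqp] := pselect (sub q p); first exact/npxy/qp.
have sq : is_ideal q by have [|[]] := Hps q; first by right.
by apply: (nx q qi); rewrite addrC idealDl in qxy => //; apply: ypsi.
Qed.

Lemma spanm_killed A us p : subm A -> primes p ->
  (forall u, u \in us -> ~ sub (ann A u) p) ->
  exists r : R, ~ p r /\ forall w, spanm A us w -> A (r *: w).
Proof.
move=> sA pp; elim: us => /= [|u us IH] Hus.
  by exists 1; split=> [|w]; [case: pp|rewrite scale1r].
have [|r [npr Hr]] := IH; first by move=> v vi; apply: Hus; rewrite inE vi orbT.
move/existsNP: (Hus u (mem_head _ _)) => [s /not_implyP[us_ nps]].
exists (s * r); split; first exact: primeN.
move=> _ [a [v [vv ->]]].
have -> : (s * r) *: (v + a *: u) = s *: (r *: v) + (r * a) *: (s *: u).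
  by mring.
by apply: submD => //; apply: submZ => //; apply: Hr.
Qed.

(** Each zero divisor lies in a maximal annihilator, which is prime. Finitely many of them suffice:
    the elements with maximal annihilator span a finitely generated submodule, and finitely many
    such elements [us] already span it modulo [A]. *)
Lemma zdiv_avoidable J B A : subm A -> subm B -> noethp B A ->
  (forall u, B u -> (forall r : R, J r -> A (r *: u)) -> A u) ->
  avoidable J (zdiv B A).
Proof.
move=> sA sB nBA J0.
pose U v := exists us, (forall u, u \in us -> maxann B A u) /\ spanm A us v.
have sU : subm U.
  split; first by exists [::]; split=> //; apply: subm0.
  move=> a x y [us [Hus xs]] [vs [Hvs ys]]; exists (us ++ vs); split.
    by move=> u; rewrite mem_cat => /orP[/Hus|/Hvs].
  have sS := spanm_subm (us ++ vs) sA.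
  apply: submP => //; [move: xs|move: ys]; apply: spanm_min => //;
    try exact: sub_spanm;
    by move=> e ee; apply: spanm_mem => //; rewrite mem_cat ee ?orbT.
pose U' v := U v /\ B v.
have [|v []//|es [esU Ues]] := nBA U'.
  by split=> [|a x y [? ?] [? ?]]; split; do ?[exact: subm0|exact: submP].
have [us [Hus ess]] : exists us, (forall u, u \in us -> maxann B A u) /\
    forall e, e \in es -> spanm A us e.
  elim: es esU {Ues} => [|e es IH] esU; first by exists [::].
  have [|us [Hus ess]] := IH; first by move=> f fi; apply: esU; rewrite inE fi orbT.
  have [[vs [Hvs vse]] _] := esU e (mem_head _ _).
  exists (us ++ vs); split.
    by move=> u; rewrite mem_cat => /orP[/Hus|/Hvs].
  have sS := spanm_subm (us ++ vs) sA.
  move=> f; rewrite inE => /orP[/eqP -> |/ess xs]; [move: vse|move: xs];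
    apply: spanm_min => //; try exact: sub_spanm;
    by move=> g gi; apply: spanm_mem => //; rewrite mem_cat gi ?orbT.
exists [seq ann A u | u <- us]; split.
  have inP p : List.In p [seq ann A u | u <- us] ->
      exists u, u \in us /\ p = ann A u.
    elim: (us) => //= u us' IH [<-|/IH[v [vi ->]]].
      by exists u; rewrite mem_head.
    by exists v; rewrite inE vi orbT.
  move=> p /inP[u [ui ->]]; split; first exact/(maxann_prime sA sB)/Hus.
  by have [Bu nAu _] := Hus u ui => Ju; apply/nAu/J0.
move=> x [b [Bb nAb Axb]].
have [u [mu bu]] := maxann_exists sA Bb nAb.
have pu := maxann_prime sA sB mu; have [Bu nAu umax] := mu.
have uus : spanm A us u.
  have : U' u.
    split=> //; exists [:: u]; split; last by apply: spanm_mem => //; rewrite mem_head.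
    by move=> v; rewrite inE => /eqP ->.
  by move=> /Ues; apply: spanm_min => //; [exact: spanm_subm|exact: sub_spanm].
(* Otherwise some element outside the prime [ann A u] would kill the whole span of [us], and in
   particular [u]. *)
have [v [vi vu]] : exists v, v \in us /\ sub (ann A v) (ann A u).
  apply: contrapT => H; have [|r [nr]] := @spanm_killed A us _ sA pu.
    by move=> v vi vu; apply: H; exists v.
  by move/(_ u uus).
have [Bv nAv vmax] := Hus v vi.
exists (ann A v); split; last by apply: (vmax u) => //; apply: bu.
elim: (us) vi => //= w ws IH; rewrite inE => /orP[/eqP -> |/IH]; first by left.
by right.
Qed.
End Annihilators.

(** * Depth *)

Section RegularSequences.
Variables (R : comNzRingType) (V : lmodType R).
Hypothesis nR : noethR R.
Implicit Types (A B C U : V -> Prop) (J p m : R -> Prop).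

Definition regm B A (x : R) := forall b, B b -> A (x *: b) -> A b.

(** The submodule A + xB, the denominator of (B/A)/x(B/A). *)
Definition red x B A : V -> Prop :=
  fun v => exists a b, [/\ A a, B b & v = a + x *: b].

(** Weakly regular sequences: the last quotient may vanish. This keeps the predicate stable under
    extensions; nonvanishing is restored by [dep_wregs]. *)
Fixpoint dep J n B A : Prop :=
  if n is k.+1 then exists x, [/\ J x, regm B A x & dep J k B (red x B A)]
  else True.

Lemma red_subm x B A : subm A -> subm B -> subm (red x B A).
Proof.
move=> sA sB; split.
  by exists 0, 0; split; rewrite ?scaler0 ?addr0 //; apply: subm0.
move=> c _ _ [a [b [Aa Bb ->]]] [a' [b' [Aa' Bb' ->]]].
exists (c *: a + a'), (c *: b + b'); split; try exact: submP.
by mring.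
Qed.

Lemma sub_red x B A : subm B -> sub A (red x B A).
Proof.
move=> sB a Aa; exists a, 0; split=> //; first exact: subm0.
by rewrite scaler0 addr0.
Qed.

Lemma red_sub x B A : subm B -> sub A B -> sub (red x B A) B.
Proof.
move=> sB AB _ [a [b [Aa Bb ->]]]; apply: submD => //; first exact: AB.
exact: submZ.
Qed.

Lemma redC x y B A : red x B (red y B A) = red y B (red x B A).
Proof.
suff H (x' y' : R) : sub (red x' B (red y' B A)) (red y' B (red x' B A)).
  by apply: sub_eq; apply: H.
move=> _ [_ [b [[a [c [Aa Bc ->]]] Bb ->]]].
exists (a + x' *: b), c; split=> //; last by mring.
by exists a, b.
Qed.

Lemma noethp_sub B A A' : subm A' -> sub A A' -> noethp B A -> noethp B A'.
Proof.
move=> sA' AA' nBA U sU UB; have [es [esU Ues]] := nBA U sU UB.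
exists es; split=> // v /Ues; apply: spanm_min; first exact: spanm_subm.
  by move=> a /AA'; apply: sub_spanm.
by move=> e; apply: spanm_mem.
Qed.

Lemma noethp_red x B A : subm A -> subm B -> noethp B A ->
  noethp B (red x B A).
Proof.
by move=> sA sB; apply: noethp_sub; [apply: red_subm|apply: sub_red].
Qed.

(** For an ideal [J] this says Hom(R/J, B/A) = 0. *)
Definition unkilled J B A :=
  forall u, B u -> (forall r : R, J r -> A (r *: u)) -> A u.

Lemma regm_unkilled J B A x : J x -> regm B A x -> unkilled J B A.
Proof. by move=> Jx rx u Bu Ju; apply: rx => //; apply: Ju. Qed.

Lemma not_zdiv B A x : ~ zdiv B A x -> regm B A x.
Proof.
by move=> nz b Bb Axb; apply: contrapT => nAb; apply: nz; exists b.
Qed.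

Lemma regm_exists2 J B A B' A' : is_ideal J ->
  subm A -> subm B -> subm A' -> subm B' -> noethp B A -> noethp B' A' ->
  unkilled J B A -> unkilled J B' A' ->
  exists x, [/\ J x, regm B A x & regm B' A' x].
Proof.
move=> iJ sA sB sA' sB' nBA nBA' u u'.
have [x [Jx /not_orP[n1 n2]]] := prime_avoidance iJ
  (avoidableU (zdiv_avoidable nR sA sB nBA u)
              (zdiv_avoidable nR sA' sB' nBA' u')).
by exists x; split=> //; apply: not_zdiv.
Qed.

Lemma regm_exists J B A : is_ideal J -> subm A -> subm B -> noethp B A ->
  unkilled J B A -> exists x, J x /\ regm B A x.
Proof.
move=> iJ sA sB nBA u.
by have [x [Jx rx _]] := regm_exists2 iJ sA sB sA sB nBA nBA u u; exists x.
Qed.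

Lemma regm_exists3 J B A x y : is_ideal J -> subm A -> subm B -> noethp B A ->
  unkilled J B A -> unkilled J B (red x B A) -> unkilled J B (red y B A) ->
  exists w, [/\ J w, regm B A w, regm B (red x B A) w & regm B (red y B A) w].
Proof.
move=> iJ sA sB nBA u ux uy.
have sx := red_subm x sA sB; have sy := red_subm y sA sB.
have nx := noethp_red x sA sB nBA; have ny := noethp_red y sA sB nBA.
have [w [Jw /not_orP[/not_orP[n1 n2] n3]]] := prime_avoidance iJ (avoidableU
  (avoidableU (zdiv_avoidable nR sA sB nBA u) (zdiv_avoidable nR sx sB nx ux))
  (zdiv_avoidable nR sy sB ny uy)).
by exists w; split=> //; apply: not_zdiv.
Qed.

(* The socle of [B / (A + x B)] relative to [J] does not depend on the regular
   element [x] of [J]: map [z] to [w] with [y z = x w]. *)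
Lemma unkilled_exchange J B A x y : subm A -> subm B -> J y ->
  regm B A x -> regm B A y ->
  unkilled J B (red y B A) -> unkilled J B (red x B A).
Proof.
move=> sA sB Jy rx ry uy z Bz Jz.
have [a [w [Aa Bw yz]]] := Jz y Jy.
have [|a'' [b [Aa'' Bb wE]]] := uy w Bw.
  move=> c Jc; have [a' [u [Aa' Bu cz]]] := Jz c Jc.
  exists (c *: w - y *: u), u; split=> //; last by rewrite subrK.
  apply: rx; first by apply: submB => //; apply: submZ.
  have -> : x *: (c *: w - y *: u) = y *: a' - c *: a.
    have -> : x *: (c *: w - y *: u) =
      c *: (a + x *: w) - y *: (a' + x *: u) + (y *: a' - c *: a) by mring.
    by rewrite -yz -cz scalerA mulrC -scalerA subrr add0r.
  by apply: submB => //; apply: submZ.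
exists (z - x *: b), b; split=> //; last by rewrite subrK.
apply: ry; first by apply: submB => //; apply: submZ.
have -> : y *: (z - x *: b) = a + x *: a''.
  by rewrite scalerBr yz wE; mring.
by apply: submD => //; apply: submZ.
Qed.

(** If x b = a + y v, regularity of y modulo x puts v in A + xB, say v = a' + x v'; then x kills b -
    y v' modulo A. *)
Lemma regm_swap B A x y : subm A -> subm B -> regm B A x -> regm B A y ->
  regm B (red x B A) y -> regm B (red y B A) x.
Proof.
move=> sA sB rx ry rxy b Bb [a [v [Aa Bv E]]].
have [|a' [v' [Aa' Bv' vE]]] := rxy v Bv.
  exists (- a), b; split=> //; first exact: submN.
  by rewrite E addKr.
exists (b - y *: v'), v'; split=> //; last by rewrite subrK.
apply: rx; first by apply: submB => //; apply: submZ.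
have -> : x *: (b - y *: v') = a + y *: a'.
  by rewrite scalerBr E vE; mring.
by apply: submD => //; apply: submZ.
Qed.

(** The remaining length does not depend on the first element chosen; this plays the role of the
    description of depth by Ext. The given [y] may be a zero divisor modulo [x], so a third element
    [w], regular modulo both, mediates: replace [y] by [w], then [w] by [x], each time using
    induction after one reduction. [unkilled_exchange] is what makes [w] exist modulo [x]. *)
Lemma dep_red J n B A x : is_ideal J -> subm A -> subm B -> noethp B A ->
  dep J n.+1 B A -> J x -> regm B A x -> dep J n B (red x B A).
Proof.
move=> iJ; elim: n A x => [//|n IH] A x sA sB nBA [y [Jy ry dy]] Jx rx.
have uy : unkilled J B (red y B A) by case: dy => z [Jz rz _]; apply: regm_unkilled rz.
have ux : unkilled J B (red x B A) by apply: unkilled_exchange uy.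
have [w [Jw rw rwx rwy]] := regm_exists3 iJ sA sB nBA (regm_unkilled Jx rx) ux uy.
have [sx sy sw] : [/\ subm (red x B A), subm (red y B A) & subm (red w B A)].
  by split; apply: red_subm.
have nw := noethp_red w sA sB nBA.
have dyw := IH _ w sy sB (noethp_red y sA sB nBA) dy Jw rwy.
have dw : dep J n.+1 B (red w B A).
  exists y; split=> //; first exact: regm_swap.
  by rewrite redC.
have := IH _ x sw sB nw dw Jx (regm_swap sA sB rx rw rwx).
by rewrite redC => dxw; exists w.
Qed.

Lemma depW J n B A : dep J n.+1 B A -> dep J n B A.
Proof.
elim: n A => [//|n IH] A [x [Jx rx dx]]; exists x; split=> //; exact: IH.
Qed.

Lemma depS J n B A : dep J n.+1 B A -> unkilled J B A.
Proof. by case=> x [Jx rx _]; apply: regm_unkilled rx. Qed.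

Definition addm A C : V -> Prop := fun v => exists a c, [/\ A a, C c & v = a + c].

Lemma addm_subm A C : subm A -> subm C -> subm (addm A C).
Proof.
move=> sA sB; split.
  by exists 0, 0; split; rewrite ?addr0 //; apply: subm0.
move=> c _ _ [a [b [Aa Bb ->]]] [a' [b' [Aa' Bb' ->]]].
exists (c *: a + a'), (c *: b + b'); split; try exact: submP.
by mring.
Qed.

(* The exact sequence is [A1/A0 -> B1/B0 -> B1/(A1 + B0)]; a common regular
   element preserves its shape. *)
Lemma dep_extension J n A1 A0 B1 B0 : is_ideal J ->
  subm A1 -> subm A0 -> subm B1 -> subm B0 ->
  sub A1 B1 -> sub A0 B0 -> (forall a, A1 a -> B0 a -> A0 a) ->
  noethp A1 A0 -> noethp B1 (addm A1 B0) ->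
  dep J n A1 A0 -> dep J n B1 (addm A1 B0) -> dep J n B1 B0.
Proof.
move=> iJ sA1 + sB1 + AB1; elim: n A0 B0 => [//|n IH] A0 B0 sA0 sB0 AB0 AB nA nB dA dB.
have sC := addm_subm sA1 sB0.
have [w [Jw rA rC]] :=
  regm_exists2 iJ sA0 sA1 sC sB1 nA nB (depS dA) (depS dB).
have dwA := dep_red iJ sA0 sA1 nA dA Jw rA.
have dwC := dep_red iJ sC sB1 nB dB Jw rC.
have E : addm A1 (red w B1 B0) = red w B1 (addm A1 B0).
  apply: sub_eq.
    move=> _ [a [_ [Aa [b0 [b [Bb0 Bb ->]]] ->]]].
    by exists (a + b0), b; split; [exists a, b0| |rewrite addrA].
  move=> _ [_ [b [[a [b0 [Aa Bb0 ->]]] Bb ->]]].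
  by exists a, (b0 + w *: b); split; [|exists b0, b|rewrite addrA].
have B0C : sub B0 (addm A1 B0).
  by move=> b Bb; exists 0, b; rewrite add0r; split=> //; apply: subm0.
exists w; split=> //.
  move=> b Bb wb; have [a [b0 [Aa Bb0 bE]]] := rC b Bb (B0C _ wb).
  rewrite bE; apply: submD => //; apply/AB0/rA => //; apply: AB; first exact: submZ.
  have -> : w *: a = w *: b - w *: b0 by rewrite bE; mring.
  by apply: submB => //; apply: submZ.
apply: IH dwA _; rewrite ?E; try exact: red_subm.
- by move=> _ [a [a' [Aa Aa' ->]]]; exists a, a'; split; auto.
(* Exactness on the left survives reduction because [w] is regular on the quotient term: [b] can be
   moved into [A1]. *)
- move=> a Aa [b0 [b [Bb0 Bb aE]]].
  have [|a1 [b0' [Aa1 Bb0' bE]]] := rC b Bb.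
    exists a, (- b0); split=> //; first exact: submN.
    by rewrite aE addrC addKr.
  exists (a - w *: a1), a1; split=> //; last by rewrite subrK.
  apply: AB; first by apply: submB => //; apply: submZ.
  have -> : a - w *: a1 = b0 + w *: b0' by rewrite aE bE; mring.
  by apply: submD => //; apply: submZ.
- exact: noethp_red.
- exact: noethp_red.
- exact: dwC.
Qed.

End RegularSequences.

(** * Invariance of depth and finite generation under isomorphism of quotients *)

Section Transfer.
Variables (R : comNzRingType) (V W : lmodType R).

Definition lin (f : V -> W) := forall a x y, f (a *: x + y) = a *: f x + f y.

Section Linear.
Variable f : V -> W.
Hypothesis fl : lin f.

Lemma lin0 : f 0 = 0.
Proof. by have := fl (-1) 0 0; rewrite scaler0 addr0 scaleN1r addNr. Qed.

Lemma linZ a u : f (a *: u) = a *: f u.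
Proof. by have := fl a u 0; rewrite !addr0 lin0 addr0. Qed.

Lemma linD u v : f (u + v) = f u + f v.
Proof. by have := fl 1 u v; rewrite !scale1r. Qed.

Lemma linB u v : f (u - v) = f u - f v.
Proof. by rewrite linD -scaleN1r linZ scaleN1r. Qed.
End Linear.

Definition induces_iso (f : V -> W) (B A : V -> Prop) (B' A' : W -> Prop) :=
  [/\ lin f,
      forall b, B b -> B' (f b),
      forall b, B b -> (A' (f b) <-> A b)
    & forall w, B' w -> exists b a', [/\ B b, A' a' & w = f b + a']].

Lemma induces_iso_red f B A B' A' x : subm B -> subm A' -> subm A ->
  induces_iso f B A B' A' ->
  induces_iso f B (red x B A) B' (red x B' A').
Proof.
move=> sB sA' sA [fl fB fA fs].
have f0 := lin0 fl.
have fZ := linZ fl.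
have fD := linD fl.
have fBB := linB fl.
split=> //.
  move=> b Bb; split.
    move=> [a' [b' [Aa' Bb' fbE]]].
    have [b1 [a'' [Bb1 Aa'' bE]]] := fs b' Bb'.
    exists (b - x *: b1), b1; split=> //; last by rewrite subrK.
    apply/fA; first by apply: submB => //; apply: submZ.
    have -> : f (b - x *: b1) = a' + x *: a''.
      by rewrite fBB fZ fbE bE; mring.
    by apply: submD => //; apply: submZ.
  move=> [a [b' [Aa Bb' bE]]]; exists (f a), (f b'); rewrite bE fD fZ.
  split=> //; last exact: fB.
  apply/fA => //; have -> : a = b - x *: b' by rewrite bE addrK.
  by apply: submB => //; apply: submZ.
move=> w /fs[b [a' [Bb Aa' ->]]]; exists b, a'; split=> //.
exists a', (f 0); split=> //; last by rewrite f0 scaler0 addr0.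
by apply: fB; apply: subm0.
Qed.

Lemma regm_iso f B A B' A' x : subm B -> subm A' ->
  induces_iso f B A B' A' -> regm B A x <-> regm B' A' x.
Proof.
move=> sB sA' [fl fB fA fs].
have f0 := lin0 fl.
have fZ := linZ fl.
split=> r b Bb.
  have [b1 [a' [Bb1 Aa' ->]]] := fs b Bb; rewrite scalerDr => H.
  have {}H : A' (x *: f b1).
    by rewrite addrC submDl in H => //; apply: submZ.
  apply: submD => //; apply/fA => //; apply: r => //.
  by apply/fA; [exact: submZ|rewrite fZ].
move=> xb; apply/fA => //; apply: r; first exact: fB.
by rewrite -fZ; apply/fA => //; apply: submZ.
Qed.

Lemma dep_iso f J n B A B' A' : subm B -> subm A -> subm B' -> subm A' ->
  induces_iso f B A B' A' -> dep J n B A <-> dep J n B' A'.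
Proof.
move=> sB + sB'; elim: n A A' => [//|n IH] A A' sA sA' fi /=.
have H x : dep J n B (red x B A) <-> dep J n B' (red x B' A').
  by apply: IH; [exact: red_subm|exact: red_subm|exact: induces_iso_red].
by split=> -[x [Jx rx dx]]; exists x; split=> //;
  try exact/H; apply/(regm_iso _ sB sA' fi).
Qed.

Lemma noethp_iso f B A B' A' : subm B -> subm A -> subm A' -> sub A B ->
  induces_iso f B A B' A' -> noethp B A -> noethp B' A'.
Proof.
move=> sB sA sA' AB [fl fB fA fs] nBA U sU UB.
have f0 := lin0 fl.
have fZ := linZ fl.
have fD := linD fl.
(* The inverse image of [U] in [B]; each generator [e] is corrected by some [a'] so that its image
   falls in [U] itself. *)
pose T b := B b /\ exists a', A' a' /\ U (f b + a').
have [|b []//|es [esT Tes]] := nBA T.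
  split.
    split; first exact: subm0.
    by exists 0; rewrite f0 addr0; split; apply: subm0.
  move=> c b1 b2 [Bb1 [a1 [Aa1 Ub1]]] [Bb2 [a2 [Aa2 Ub2]]].
  split; first exact: submP.
  exists (c *: a1 + a2); split; first exact: submP.
  have -> : f (c *: b1 + b2) + (c *: a1 + a2) = c *: (f b1 + a1) + (f b2 + a2).
    by rewrite fl; mring.
  exact: submP.
have [us [usU usf]] : exists us, (forall u, u \in us -> U u) /\
    forall e, e \in es -> spanm A' us (f e).
  elim: es esT {Tes} => [|e es IH] esT; first by exists [::].
  have [|us [usU usf]] := IH; first by move=> g gi; apply: esT; rewrite inE gi orbT.
  have [_ [a' [Aa' Ue]]] := esT e (mem_head _ _).
  exists (f e + a' :: us); split.
    by move=> u; rewrite inE => /orP[/eqP ->|/usU].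
  move=> g; rewrite inE => /orP[/eqP ->|/usf H] /=.
    exists 1, (- a'); split; last by rewrite scale1r addrC addrK.
    by apply: sub_spanm; apply: submN.
  by exists 0, (f g); rewrite scale0r addr0.
exists us; split=> // w Uw; have [b [a' [Bb Aa' wE]]] := fs w (UB _ Uw).
have sS := spanm_subm us sA'.
have /Tes bes : T b.
  split=> //; exists a'; split=> //; by rewrite -wE.
rewrite wE; apply: submD => //; last exact: sub_spanm.
have [b' [a0 [Aa0 bE fb']]] : exists b' a0,
    [/\ A a0, b = b' + a0 & spanm A' us (f b')].
  elim: es {Tes esT} usf b bes {Bb wE} => [|e es IH] usf b /=.
    by move=> Ab; exists 0, b; rewrite add0r f0; split=> //; apply: subm0.
  move=> [r [u [uu ->]]]; have [|b' [a0 [Aa0 uE fb']]] := IH _ u uu.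
    by move=> g gi; apply: usf; rewrite inE gi orbT.
  exists (b' + r *: e), a0; split=> //; first by rewrite uE addrAC.
  rewrite fD fZ; apply: submD => //; apply: submZ => //.
  by apply: usf; rewrite mem_head.
rewrite bE fD; apply: submD => //; apply: sub_spanm; apply/fA => //.
exact: AB.
Qed.
End Transfer.

(** * Chains of primes and the splitting of extensions *)

Section Chains.
Variable R : comNzRingType.
Implicit Types (I J p q : R -> Prop) (S : (R -> Prop) -> Prop).

(** As a set of [n] this is an initial segment of the naturals, so inclusion of such sets compares
    dimensions, infinite ones included. *)
Definition chainS S n := exists P : nat -> R -> Prop,
  (forall i, (i <= n)%N -> S (P i)) /\
  (forall i, (i < n)%N -> sub (P i) (P i.+1) /\ ~ sub (P i.+1) (P i)).

Lemma chain0 S p : S p -> chainS S 0.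
Proof. by move=> Sp; exists (fun=> p). Qed.

Lemma chainW S n k : (k <= n)%N -> chainS S n -> chainS S k.
Proof.
move=> kn [P [SP PP]]; exists P; split=> i ik.
  by apply: SP; apply: leq_trans kn.
by apply: PP; apply: leq_trans kn.
Qed.

Lemma chain_sub S S' n : (forall p, S p -> S' p) -> chainS S n -> chainS S' n.
Proof. by move=> SS' [P [SP PP]]; exists P; split=> // i /SP /SS'. Qed.

Lemma chain_cons S S' n : (forall p, S p -> S' p) ->
  (forall p, S p -> exists q, [/\ S' q, sub q p & ~ sub p q]) ->
  chainS S n -> chainS S' n.+1.
Proof.
move=> SS' ext [P [SP PP]]; have [q [Sq qP Pq]] := ext _ (SP 0%N isT).
exists (fun i => if i is k.+1 then P k else q); split=> -[|i] //.
  by rewrite ltnS => /SP /SS'.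
exact: PP.
Qed.

Definition over J p := primes p /\ sub J p.

Lemma over_sub J J' n : sub J J' -> chainS (over J') n -> chainS (over J) n.
Proof.
by move=> JJ'; apply: chain_sub => p [pp J'p]; split=> // x /JJ' /J'p.
Qed.

(** The prime is found disjoint from the multiplicative set of all s x^k with s outside [p]: a prime
    of the localization at [p] with [x] inverted. *)
Lemma prime_below J p (x : R) : noethR R -> is_ideal J -> primes p ->
  (forall s k, ~ p s -> ~ J (s * x ^+ k)) ->
  exists q, [/\ over J q, sub q p & ~ q x].
Proof.
move=> nR iJ pp H.
have np1 : ~ p 1 by case: pp.
have [|||q [pq Jq qS]] := @prime_avoiding R J
  (fun t => exists s k, ~ p s /\ t = s * x ^+ k) nR iJ.
- by exists 1, 0%N; rewrite mul1r expr0.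
- move=> _ _ [s [k [ns ->]]] [s' [k' [ns' ->]]]; exists (s * s'), (k + k')%N.
  by split; [exact: primeN|rewrite exprD mulrACA].
- by move=> t Jt [s [k [ns tE]]]; apply: (H s k ns); rewrite -tE.
exists q; split=> // [t qt|qx].
  apply: contrapT => npt; apply: (qS t qt).
  by exists t, 0%N; rewrite expr0 mulr1.
by apply: (qS x qx); exists 1, 1%N; rewrite mul1r expr1.
Qed.
End Chains.

(** * Nakayama at a prime and bounds of depth by dimension *)

Section LocalDepth.
Variables (R : comNzRingType) (V : lmodType R) (m : R -> Prop).
Hypotheses (nR : noethR R) (pm : primes m).
Implicit Types (A B U : V -> Prop) (J p : R -> Prop).

Definition suppm B A p :=
  primes p /\ exists x, B x /\ forall s : R, ~ p s -> ~ A (s *: x).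

Lemma suppm_ann B A p u : primes p -> B u -> sub (ann A u) p -> suppm B A p.
Proof.
by move=> pp Bu up; split=> //; exists u; split=> // s ns /(up s).
Qed.

(* Nakayama's lemma for the localization at m, by eliminating generators. *)
Lemma local_nakayama A es x : subm A -> m x ->
  (forall u, spanm A es u ->
     exists s, ~ m s /\ red x (spanm A es) A (s *: u)) ->
  exists t, ~ m t /\ forall u, spanm A es u -> A (t *: u).
Proof.
have [im nm1 _] := pm => sA mx; elim: es => /= [|e es IH] H.
  by exists 1; split=> // u; rewrite scale1r.
have sS := spanm_subm es sA.
have [|s [ns [a [_ [Aa [r [u' [Su' ->]]] seE]]]]] := H e.
  by exists 1, 0; rewrite scale1r add0r; split=> //; apply: subm0.
(* From s e = a + x (u' + r e): this multiplier is outside [m], as [x] is in [m], and it sends [e]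
   into the span of the other generators. *)
pose t0 := s - x * r.
have nt0 : ~ m t0.
  move=> mt; apply: ns; rewrite -[s](subrK (x * r)); apply: idealD => //.
  exact: idealMr.
have t0e : spanm A es (t0 *: e).
  have -> : t0 *: e = a + x *: u'.
    have -> : t0 *: e = s *: e - (x * r) *: e by rewrite scalerBl.
    by rewrite seE; mring.
  apply: submD => //; first exact: sub_spanm.
  exact: submZ.
have [u Su|t [nt Ht]] := IH.
  have [|s' [ns' [b [_ [Ab [r' [v [Sv ->]]] uE]]]]] := H u.
    by exists 0, u; rewrite scale0r addr0.
  exists (t0 * s'); split; first exact: primeN.
  exists (t0 *: b), (t0 *: v + r' *: (t0 *: e)); split; first exact: submZ.
    by apply: submD => //; apply: submZ.
  by rewrite -scalerA uE; mring.
exists (t * t0); split; first exact: primeN.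
move=> _ [r' [v [Sv ->]]].
have -> : (t * t0) *: (v + r' *: e) = t0 *: (t *: v) + r' *: (t *: (t0 *: e)).
  by mring.
by apply: submD => //; apply: submZ => //; apply: Ht.
Qed.

(** The element [w] shows that U/A is nonzero at [m], so by Nakayama it differs there from its
    multiple by [x]. *)
Lemma nakayama_witness A B U x w : subm A -> subm U -> sub A U -> sub U B ->
  noethp B A -> m x -> U w -> sub (ann A w) m ->
  exists u, U u /\ forall s, ~ m s -> ~ red x U A (s *: u).
Proof.
move=> sA sU AU UB nBA mx Uw wm; apply: contrapT => H.
have [es [esU Ues]] := nBA U sU UB.
have E : U = spanm A es by apply: sub_eq => //; apply: spanm_min.
have [u|t [nt Ht]] := @local_nakayama A es x sA mx.
  rewrite -E => Uu; apply: contrapT => H'; apply: H; exists u; split=> // s ns rs.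
  by apply: H'; exists s.
by apply/nt/wm/Ht; rewrite -E.
Qed.

Lemma suppm_red A B x : subm A -> subm B -> sub A B -> noethp B A -> m x ->
  suppm B A m -> suppm B (red x B A) m.
Proof.
move=> sA sB AB nBA mx [_ [w [Bw wm]]]; split=> //.
apply: (nakayama_witness (w := w) sA sB AB _ nBA mx Bw) => // r Ar.
by apply: contrapT => /wm.
Qed.

(** Induction along the regular sequence: Nakayama gives an element v, killed by ann(u) modulo A,
    that is nonzero at m modulo A + xB. The annihilator of v modulo A + xB contains ann(u) and x, so
    a chain over it can be prolonged downwards by a prime over ann(u) that avoids x. *)
Lemma dep_chain n A B u : subm A -> subm B -> sub A B -> noethp B A ->
  dep m n B A -> B u -> sub (ann A u) m -> chainS (over (ann A u)) n.
Proof.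
have [im _ _] := pm.
elim: n A u => [|n IH] A u sA sB AB nBA; first by move=> _ _ um; apply: (@chain0 _ _ m).
move=> [x [mx rx dx]] Bu um.
pose U v := B v /\ forall r, ann A u r -> A (r *: v).
have sU : subm U.
  split; first by split; [exact: subm0|move=> r _; rewrite scaler0; exact: subm0].
  move=> a v w [Bv uv] [Bw uw]; split; first exact: submP.
  move=> r ur; have -> : r *: (a *: v + w) = a *: (r *: v) + r *: w by mring.
  by apply: submP; auto.
have [|||v [[Bv uv] nv]] := @nakayama_witness A B U x u sA sU _ _ nBA mx _ um.
- by move=> a Aa; split; [exact: AB|move=> r _; apply: submZ].
- by move=> v [].
- by split.
(* If s v = a + x b, regularity of [x] forces [b] into [U], against the choice of [v] outside x
   [U]. *)
have nBv s : ~ m s -> ~ red x B A (s *: v).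
  move=> ns [a [b [Aa Bb svE]]]; apply: (nv s ns); exists a, b; split=> //.
  split=> // r ur; apply: rx; first exact: submZ.
  have -> : x *: (r *: b) = s *: (r *: v) - r *: a.
    have -> : s *: (r *: v) = r *: (s *: v) by mring.
    by rewrite svE; mring.
  by apply: submB; auto; apply: submZ; auto.
have sr := red_subm x sA sB.
have vm : sub (ann (red x B A) v) m by move=> r Ar; apply: contrapT => /nBv.
have := IH _ v sr sB (red_sub (x := x) sB AB) (noethp_red x sA sB nBA) dx Bv vm.
have uv' : sub (ann A u) (ann (red x B A) v).
  by move=> r /uv; apply: sub_red.
apply: chain_cons => p [pp vp]; first by split=> // r /uv' /vp.
have [||q [[pq uq] qp nqx]] := @prime_below R (ann A u) p x nR _ pp.
- exact: ann_ideal.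
- move=> s k ns H; apply: ns; apply/vp/uv'.
  have : A (x ^+ k *: (s *: u)) by rewrite scalerA mulrC.
  elim: k {H} => [|k IHk]; first by rewrite expr0 scale1r.
  rewrite exprS -scalerA => H; apply: IHk; apply: (rx _ _ H).
  by do 2 apply: (submZ sB).
exists q; split=> // pq'; apply/nqx/pq'/vp.
by exists 0, v; rewrite add0r; split=> //; apply: subm0.
Qed.

(** The counterpart of [regular_seq] for B/A; unlike in [dep], the final quotient must be
    nonzero. *)
Fixpoint wregs (xs : seq R) B A : Prop :=
  if xs is x :: xs' then regm B A x /\ wregs xs' B (red x B A)
  else exists b, B b /\ ~ A b.

(** By Nakayama [m] stays in the support after each reduction, so the final quotient is nonzero. *)
Lemma dep_wregs n A B : subm A -> subm B -> sub A B -> noethp B A ->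
  suppm B A m -> dep m n B A ->
  exists xs, [/\ size xs = n, forall x, x \in xs -> m x & wregs xs B A].
Proof.
have [_ nm1 _] := pm.
elim: n A => [|n IH] A sA sB AB nBA sm.
  move=> _; exists [::]; split=> //; case: sm => _ [b [Bb nb]].
  by exists b; split=> //; rewrite -[b]scale1r; apply: nb.
move=> [x [mx rx dx]].
have [||||xs [sx mxs wx]] := IH (red x B A) _ sB _ _ _ dx.
- exact: red_subm.
- exact: red_sub.
- exact: noethp_red.
- exact: suppm_red.
exists (x :: xs); split=> /=; first by rewrite sx.
  by move=> y; rewrite inE => /orP[/eqP ->|/mxs].
by [].
Qed.

Lemma dep_of_wregs xs A B : (forall x, x \in xs -> m x) ->
  wregs xs B A -> dep m (size xs) B A.
Proof.
elim: xs A => [//|x xs IH] A mxs [rx wx]; exists x; split=> //.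
  by apply: mxs; rewrite mem_head.
by apply: IH => // y yi; apply: mxs; rewrite inE yi orbT.
Qed.

(** This is depth <= dim. Every prime in the support of B/(A + xB) contains [x], and below it there
    is a prime in the support of B/A avoiding [x]. *)
Lemma wregs_chain xs A B : subm A -> subm B -> sub A B ->
  wregs xs B A -> chainS (suppm B A) (size xs).
Proof.
elim: xs A => [|x xs IH] A sA sB AB /=.
  move=> [b [Bb nAb]].
  have [||||p [pp bp _]] := @prime_avoiding R (ann A b) (fun t => t = 1) nR.
  - exact: ann_ideal.
  - by [].
  - by move=> _ _ -> ->; rewrite mulr1.
  - by move=> t tb t1; move: tb; rewrite t1 /ann scale1r.
  by apply: (@chain0 _ _ p); apply: (suppm_ann pp Bb bp).
move=> [rx /IH].
move/(_ (red_subm x sA sB) sB (red_sub (x := x) sB AB)).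
have sAr := @sub_red _ _ x _ A sB.
apply: chain_cons => p [pp [b [Bb nb]]].
  by split=> //; exists b; split=> // s /nb ns /sAr.
have [||q [[pq bq] qp nqx]] := @prime_below R (ann A b) p x nR _ pp.
- exact: ann_ideal.
- move=> s k /nb ns H; apply/ns/sAr.
  have : A (x ^+ k *: (s *: b)) by rewrite scalerA mulrC.
  elim: k {H} => [|k IHk]; first by rewrite expr0 scale1r.
  rewrite exprS -scalerA => H; apply: IHk; apply: (rx _ _ H).
  by do 2 apply: (submZ sB).
exists q; split=> //; first exact: suppm_ann bq.
move=> pq'; apply/nqx/pq'; apply: contrapT => npx; apply: (nb x npx).
by exists 0, b; rewrite add0r; split=> //; apply: subm0.
Qed.
End LocalDepth.

(* A class of ideals, closed under the operations of the splitting argument,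
   and of elements, for which m behaves like the maximal ideal of a local
   ring: all ideals of a local ring, or the graded ideals of a graded one. *)
Record local_class (R : comNzRingType) (m : R -> Prop)
    (H : (R -> Prop) -> Prop) (h : R -> Prop) := LocalClass {
  lc_ideal : forall I, H I -> is_ideal I;
  lc_sub : forall I, H I -> ~ I 1 -> sub I m;
  lc_elt : forall I J, H I -> H J -> ~ sub J I -> exists s, [/\ h s, J s & ~ I s];
  lc_gen : forall I s, H I -> h s -> H (add_gen I s);
  lc_colon : forall I J, H I -> H J -> H (fun r => forall j, J j -> I (r * j));
  lc_ann : forall I u, H I -> h u -> H (fun r => I (r * u)) }.

(** * The splitting lemma *)

Section Splitting.
Variables (R : comNzRingType) (m : R -> Prop) (H : (R -> Prop) -> Prop)
  (h : R -> Prop).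
Hypotheses (nR : noethR R) (pm : primes m) (lc : local_class m H h).
Implicit Types I J P Q : R -> Prop.

Definition depR n I := @dep R R^o m n fullm I.

(** If [J] killed a nonzero element of R/I, the colon ideal of [I] by [J] would contain some [v] of
    the class [h] outside [I]. Its annihilator modulo [I] belongs to [H], hence lies in [m], and
    [dep_chain] yields a chain of length [n] over [J]. *)
Lemma local_class_unkilled n I J : H I -> H J -> depR n I ->
  ~ chainS (over J) n -> @unkilled R R^o J fullm I.
Proof.
move=> HI HJ dI nJ u _ uJ; apply: contrapT => nIu.
have iI := lc_ideal lc HI.
have [|v [hv vL nIv]] := lc_elt lc HI (lc_colon lc HI HJ).
  move=> LI; apply/nIu/LI => j /uJ; rewrite mulrC; exact.
have vm := lc_sub lc (lc_ann lc HI hv).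
apply: nJ; apply: (@over_sub _ _ (@ann R R^o I v)).
  by move=> j /vL; rewrite mulrC.
apply: (@dep_chain R R^o m nR pm n I fullm v) => //.
  exact: noethp_ideal.
by apply: vm; rewrite mul1r.
Qed.

Lemma red_add_gen I x : @red R R^o x fullm I = add_gen I x.
Proof.
apply: sub_eq => v [a [b]].
  by case=> Ia _ ->; exists b, a; split=> //; rewrite [x *: b]mulrC.
by case=> Ib ->; exists b, a; split=> //; rewrite [a * x]mulrC.
Qed.

Lemma split_extension n P Q (V : lmodType R) (A : V -> Prop) (e1 e2 : V) :
  primes P -> primes Q -> H P -> H Q -> ~ sub P Q ->
  depR n P -> ~ chainS (over Q) n -> subm A ->
  (forall r, A (r *: e1) <-> P r) ->
  (forall r, (exists c, A (r *: e2 - c *: e1)) <-> Q r) ->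
  exists a, forall q, Q q -> A (q *: (e2 - a *: e1)).
Proof.
move=> pP pQ HP HQ nPQ dP cQ sA eP eQ.
have [iP nP1 PP] := pP; have [iQ nQ1 QQ] := pQ; have [im _ _] := pm.
have [s [hs Ps nQs]] := lc_elt lc HQ HP nPQ.
(* [n] is positive because [Q] alone is a chain of length 0. The next case split on [n] uses [m],
   which contains [J], in the same way. *)
case: n dP cQ => [_ []|n dP cQ]; first by apply: (@chain0 _ _ Q); split=> // x.
pose J := add_gen Q s; have HJ : H J by apply: (lc_gen lc).
have iJ := lc_ideal lc HJ.
have Qm := lc_sub lc HQ nQ1; have Pm := lc_sub lc HP nP1.
have Jm : sub J m.
  move=> _ [r [u [Qu ->]]]; apply: idealD => //; first exact: Qm.
  by apply: idealM => //; apply: Pm.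
(* Primes over [J] contain [s], and [Q] does not, so [Q] prolongs every chain over [J]. *)
have cJ : ~ chainS (over J) n.
  move=> cJ; apply: cQ; move: cJ; apply: chain_cons => p [pp Jp].
    by split=> // x Qx; apply/Jp/sub_add_gen.
  exists Q; split; first by split=> // x.
    by move=> x Qx; apply/Jp/sub_add_gen.
  by move=> pQ'; apply/nQs/pQ'/Jp; apply: add_gen_mem.
have nPf := noethp_ideal nR iP.
(* [x] is taken in [h] so that [P] + ([x]) stays in [H]; [y] below is subject to no such
   condition. *)
have [|x [hx Jx nPx]] := lc_elt lc HP HJ.
  move=> JP; apply: cJ; apply: (@over_sub _ _ (@ann R R^o P 1)).
    by move=> j /JP; rewrite /ann [_ *: _]mulr1.
  apply: (@dep_chain R R^o m nR pm n P fullm 1) => //; first exact: depW.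
  by move=> r; rewrite /ann [_ *: _]mulr1; apply: Pm.
case: n dP cQ cJ => [_ _ []|n dP cQ cJ]; first by apply: (@chain0 _ _ m); split=> // x.
have rx : @regm R R^o fullm P x by move=> b _ /PP[].
have dx := @dep_red R R^o nR m n.+1 _ _ x im iP (@fullm_subm _ _) nPf dP (Jm _ Jx) rx.
have Hx : H (add_gen P x) by apply: (lc_gen lc).
have [y [Jy ry]] : exists y, J y /\ @regm R R^o fullm (add_gen P x) y.
  have ix := lc_ideal lc Hx.
  apply: (@regm_exists R R^o nR J fullm (add_gen P x)) => //.
    exact: noethp_ideal.
  apply: (local_class_unkilled Hx HJ) cJ.
    by rewrite /depR -red_add_gen.
(* Modulo [B] the extension is one of R/J by R/P; the scalars c with j e2 - c e1 in [B] define the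
   linear map from [J] to R/P. *)
pose B := spanm A [:: s *: e2].
have sB : subm B by apply: spanm_subm.
have AB : sub A B by apply: sub_spanm.
have Be1 r : B (r *: e1) <-> P r.
  split; last by move=> /eP /AB.
  move=> [t [a [Aa E]]].
  have Qts : Q (t * s).
    apply/eQ; exists r; rewrite E.
    have -> : (t * s) *: e2 - (a + t *: (s *: e2)) = - a by mring.
    exact: submN.
  have Qt : Q t by case: (QQ _ _ Qts).
  apply/eP; rewrite E; apply: submD => //.
  have [c Ac] := (eQ t).2 Qt.
  have -> : t *: (s *: e2) = s *: (t *: e2 - c *: e1) + c *: (s *: e1) by mring.
  by apply: submD => //; apply: submZ => //; apply/eP.
have BJ j : J j -> exists c, B (j *: e2 - c *: e1).
  move=> [r [q [/eQ[c Ac] ->]]]; exists c.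
  exists r, (q *: e2 - c *: e1); split=> //; by mring.
have [cx Bcx] := BJ x Jx; have [cy Bcy] := BJ y Jy.
(* Linearity of that map: j f(k) = k f(j). *)
have cross j k cj ck : B (j *: e2 - cj *: e1) -> B (k *: e2 - ck *: e1) ->
    P (j * ck - k * cj).
  move=> Bj Bk; apply/Be1.
  have -> : (j * ck - k * cj) *: e1 =
    k *: (j *: e2 - cj *: e1) - j *: (k *: e2 - ck *: e1) by mring.
  by apply: submB => //; apply: submZ.
have [a [p [Pp cxE]]] : add_gen P x cx.
  apply: ry => //; exists cy, (y * cx - x * cy); split; first exact: cross.
  by change (y * cx = y * cx - x * cy + cy * x); ring.
exists a => q Qq.
have Jq : J q by apply: sub_add_gen.
have [cq Bcq] := BJ q Jq.
have Pq : P (cq - q * a).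
  have : P (x * (cq - q * a)).
    have -> : x * (cq - q * a) = (x * cq - q * cx) + q * p by rewrite cxE; ring.
    by apply: idealD => //; [exact: cross|exact: idealM].
  by case/PP.
have : B (q *: (e2 - a *: e1)).
  have -> : q *: (e2 - a *: e1) = (q *: e2 - cq *: e1) + (cq - q * a) *: e1.
    by mring.
  by apply: submD => //; apply/Be1.
move=> [t [b [Ab E]]].
(* Return from [B] to [A]: the multiple t s e2 has [t] in [Q], since [s] is outside the prime [Q],
   and it lies in [A] because [s] kills [e1]. *)
have Qts : Q (t * s).
  apply/eQ; have [c Ac] := (eQ q).2 Qq; exists (c - q * a).
  have -> : (t * s) *: e2 - (c - q * a) *: e1 =
     (q *: e2 - c *: e1) - b + ((b + t *: (s *: e2)) - q *: (e2 - a *: e1)).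
    by mring.
  by rewrite -E subrr addr0; apply: submB.
have Qt : Q t by case: (QQ _ _ Qts).
rewrite E; apply: submD => //.
have [c Ac] := (eQ t).2 Qt.
have -> : t *: (s *: e2) = s *: (t *: e2 - c *: e1) + c *: (s *: e1) by mring.
by apply: submD => //; apply: submZ => //; apply/eP.
Qed.
End Splitting.

(** * Sorting prime filtrations *)

Section PrimeFiltrations.
Variables (R : comNzRingType) (m : R -> Prop) (H : (R -> Prop) -> Prop)
  (h : R -> Prop) (V : lmodType R) (P : nat -> R -> Prop).
Hypotheses (nR : noethR R) (pm : primes m) (lc : local_class m H h).
Implicit Types (A B C N : V -> Prop) (L : seq nat) (I : R -> Prop).

(** Steps are listed by their indices into [P], so reordering a filtration means permuting [L]; the
    generators stay existential because a swap changes them. *)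
Fixpoint pfilt L A B : Prop :=
  if L is i :: L' then
    exists e, (forall r, A (r *: e) <-> P i r) /\ pfilt L' (spanm A [:: e]) B
  else A = B.

Definition chains i : nat -> Prop := chainS (over (P i)).

(** The last clause is dim R/P <= depth R/P, where P = [P i]. *)
Definition good i :=
  [/\ primes (P i), H (P i) & forall n, chains i n -> depR m n (P i)].

Definition dim_le : rel nat := fun i j => `[< sub (chains i) (chains j) >].

Lemma dim_le_total : total dim_le.
Proof.
move=> i j; apply/orP; have [ij|nij] := pselect (sub (chains i) (chains j)).
  by left; apply/asboolP.
right; apply/asboolP => n jn; move/existsNP: nij => [k /not_implyP[ik njk]].
have [nk|/ltnW kn] := leqP n k; first exact: chainW nk ik.
by case: njk; apply: chainW kn jn.
Qed.

Lemma dim_le_trans : transitive dim_le.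
Proof.
by move=> j i k /asboolP ij /asboolP jk; apply/asboolP => n /ij /jk.
Qed.

Lemma good_sub i : good i -> sub (P i) m.
Proof. by move=> [[_ nP1 _] HP _]; apply: (lc_sub lc). Qed.

Lemma pfilt_cat L1 L2 A B :
  pfilt (L1 ++ L2) A B <-> exists C, pfilt L1 A C /\ pfilt L2 C B.
Proof.
elim: L1 A => [|i L1 IH] A /=.
  by split=> [pB|[C [-> //]]]; exists A.
split=> [[e [eP /IH[C [pC pB]]]]|[C [[e [eP pC]] pB]]].
  by exists C; split=> //; exists e.
by exists e; split=> //; apply/IH; exists C.
Qed.

Lemma pfilt_sub L A B : subm A -> pfilt L A B -> subm B /\ sub A B.
Proof.
elim: L A => [|i L IH] A sA /=; first by move=> <-; split=> // v.
move=> [e [_ /IH[|sB CB]]]; first exact: (spanm_subm [:: e]).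
by split=> // v Av; apply: CB; apply: (@sub_spanm _ _ A [:: e]).
Qed.

(** The splitting replaces [e2] by e2 - a e1, whose annihilator modulo [A] is already [P j]; then
    [e1] is adjoined second, and both orders reach the same submodule. *)
Lemma pfilt_swap i j L A B : good i -> good j -> ~ sub (P i) (P j) ->
  ~ dim_le i j -> subm A -> pfilt [:: i, j & L] A B -> pfilt [:: j, i & L] A B.
Proof.
move=> [pi Hi ci] [pj Hj _] nij nd sA.
have [n [ni nj]] : exists n, chains i n /\ ~ chains j n.
  apply: contrapT => nn; apply: nd; apply/asboolP => n ni.
  by apply: contrapT => nj; apply: nn; exists n.
move=> [e1 [e1P [e2 [e2P pB]]]].
have [|a aQ] := split_extension nR pm lc pi pj Hi Hj nij (ci _ ni) nj sA e1P (e2 := e2).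
  move=> r; rewrite -e2P; split=> [[c Ac]|[c [u [Au E]]]].
    by exists c, (r *: e2 - c *: e1); rewrite subrK.
  by exists c; rewrite E addrK.
set e2' := e2 - a *: e1 in aQ.
have eE r u : u + r *: e2 = u + (r * a) *: e1 + r *: e2' by rewrite /e2'; mring.
exists e2'; split.
  move=> r; split=> [Ar|/aQ //]; apply/e2P; exists (r * a), (r *: e2'); split=> //.
  by rewrite /e2'; mring.
exists e1; split.
  move=> r; split=> [[t [u [Au E]]]|/e1P Ar]; last first.
    by exists 0, (r *: e1); rewrite scale0r addr0.
  apply/e1P; rewrite E; apply: submD => //; apply: aQ; apply/e2P.
  exists (r + t * a), (- u); split; first exact: submN.
  have -> : - u + (r + t * a) *: e1 = - u + r *: e1 + (t * a) *: e1 by mring.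
  by rewrite E /e2'; mring.
suff -> : spanm (spanm A [:: e2']) [:: e1] = spanm (spanm A [:: e1]) [:: e2] by [].
apply: sub_eq => _ [r [_ [[s [u [Au ->]]] ->]]].
  exists s, (u + (r - s * a) *: e1); split; first by exists (r - s * a), u.
  by rewrite /e2'; mring.
exists (s + r * a), (u + r *: e2'); split; first by exists r, u.
by rewrite /e2'; mring.
Qed.

(** One round of insertion sort. Whenever [i] has to pass [j], the dimensions are in the wrong
    order, so the hypothesis on [L] excludes an inclusion of [P i] in [P j] and the swap is
    allowed. *)
Lemma pfilt_insert i L A B : (forall j, j \in i :: L -> good j) -> subm A ->
  sorted dim_le L -> (forall j, j \in L -> sub (P i) (P j) -> dim_le i j) ->
  pfilt (i :: L) A B ->
  exists L', [/\ perm_eq L' (i :: L), sorted dim_le L' & pfilt L' A B].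
Proof.
elim: L A => [|j L IH] A gL sA sL iL pB; first by exists [:: i].
have [ij|nij] := boolP (dim_le i j).
  by exists [:: i, j & L]; split=> //=; rewrite ij.
have nPij : ~ sub (P i) (P j).
  by move=> /(iL j (mem_head _ _)) ij; rewrite ij in nij.
have [|||e [eP pC]] := pfilt_swap _ _ nPij _ sA pB.
- by apply: gL; rewrite mem_head.
- by apply: gL; rewrite !inE eqxx orbT.
- exact/negP.
have [||||L' [pL' sL' pL'B]] := IH _ _ _ _ _ pC.
- move=> k; rewrite inE => ki; apply: gL; rewrite !inE.
  by case/orP: ki => ->; rewrite ?orbT.
- exact: (spanm_subm [:: e]).
- exact: path_sorted sL.
- by move=> k kL; apply: iL; rewrite inE kL orbT.
exists (j :: L'); split; last by exists e.
  rewrite (perm_trans (y := [:: j, i & L])) ?perm_cons //.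
  by rewrite -[[:: j, i & L]]/([:: j] ++ [:: i] ++ L) perm_catCA.
rewrite /= path_sortedE; last exact: dim_le_trans.
rewrite sL' andbT (perm_all _ pL') /=.
have := dim_le_total i j; rewrite (negbTE nij) /= => ->.
by move: sL; rewrite /= path_sortedE; [case/andP|exact: dim_le_trans].
Qed.

(** The trace of pretty cleanness that sorting uses. The opposite inclusion of chain lengths is
    automatic, so a contained prime must have the same dimension. *)
Definition pretty : rel nat :=
  fun i j => `[< sub (P i) (P j) -> sub (chains i) (chains j) >].

Lemma pfilt_sort L A B : (forall j, j \in L -> good j) -> subm A ->
  pairwise pretty L -> pfilt L A B ->
  exists L', [/\ perm_eq L' L, sorted dim_le L' & pfilt L' A B].
Proof.
elim: L A => [|i L IH] A gL sA; first by move=> _ pB; exists [::].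
rewrite pairwise_cons => /andP[/allP iL pL] [e [eP pC]].
have [||L1 [pL1 sL1 pL1B]] := IH _ _ _ pL pC.
- by move=> j jL; apply: gL; rewrite inE jL orbT.
- exact: (spanm_subm [:: e]).
have piL : perm_eq (i :: L1) (i :: L) by rewrite perm_cons.
have [|||L' [pL' sL' pL'B]] := @pfilt_insert i L1 A B _ sA sL1.
- by move=> j; rewrite (perm_mem piL); apply: gL.
- move=> j; rewrite (perm_mem pL1) => /iL/asboolP ij Pij.
  by apply/asboolP; apply: ij.
- by exists e.
by exists L'; split=> //; apply: perm_trans pL' piL.
Qed.

Definition colon I A : V -> Prop := fun v => forall p, I p -> A (p *: v).

(** The colon of [A] by the product of the primes listed in [L], as an iterated colon. *)
Fixpoint kill L A : V -> Prop :=
  if L is i :: L' then kill L' (colon (P i) A) else A.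

Lemma kill_sub L A B : sub A B -> sub (kill L A) (kill L B).
Proof.
elim: L A B => //= i L IH A B AB; apply: IH => v Av p /Av; exact: AB.
Qed.

Lemma pfilt_killed L A B : subm A -> pfilt L A B -> sub B (kill L A).
Proof.
elim: L A => [|i L IH] A sA /=; first by move=> ->.
move=> [e [eP /IH BL]] v /BL; move/(_ (spanm_subm [:: e] sA)).
apply: kill_sub => _ [r [u [Au ->]]] p Pp.
have -> : p *: (u + r *: e) = p *: u + r *: (p *: e) by mring.
by apply: submD => //; apply: submZ => //; apply/eP.
Qed.

(** Each step R/P j is a domain in which some element of [I] is nonzero, so nothing nonzero in it is
    killed by [I]. *)
Lemma pfilt_colon L A B I : subm A -> (forall j, j \in L -> primes (P j)) ->
  (forall j, j \in L -> ~ sub I (P j)) -> pfilt L A B ->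
  forall v, B v -> colon I A v -> A v.
Proof.
elim: L A => [|j L IH] A sA pL IL /=; first by move=> ->.
move=> [e [eP pB]] v Bv Iv.
have sC := spanm_subm [:: e] sA.
have [|||r [u [Au vE]]] := IH _ sC _ _ pB v Bv.
- by move=> k kL; apply: pL; rewrite inE kL orbT.
- by move=> k kL; apply: IL; rewrite inE kL orbT.
- by move=> p /Iv; apply: (@sub_spanm _ _ A [:: e]).
move/existsNP: (IL j (mem_head _ _)) => [t /not_implyP[It nPt]].
have [_ _ pp] := pL j (mem_head _ _).
have : A ((t * r) *: e).
  have -> : (t * r) *: e = t *: v - t *: u by rewrite vE; mring.
  by apply: submB; auto; apply: submZ.
move/eP/pp => [//|/eP Are].
by rewrite vE; apply: submD.
Qed.

(** With [pfilt_killed] this characterizes [N] through its primes alone. The ideal [P i] of an early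
    step lies in no prime of a later one, so B/N has no element killed by it. *)
Lemma killE L1 L2 A N B : subm A -> pfilt L1 A N -> pfilt L2 N B ->
  (forall j, j \in L2 -> primes (P j)) ->
  (forall i j, i \in L1 -> j \in L2 -> ~ sub (P i) (P j)) ->
  forall v, B v -> kill L1 A v -> N v.
Proof.
move=> sA p1 p2 pp n12; have [sN AN] := pfilt_sub sA p1.
have sB : subm B by case: (pfilt_sub sN p2).
suff HH : forall L', {subset L' <= L1} -> forall C, sub (fun v => C v /\ B v) N ->
    forall v, B v -> kill L' C v -> N v.
  by apply: (HH L1) => // v [/AN].
elim=> [|i L' IH] sL C CN v Bv /=; first by move=> Cv; apply: CN.
apply: IH => //; first by move=> k kL; apply: sL; rewrite inE kL orbT.
move=> w [Cw Bw]; apply: (pfilt_colon (I := P i) sN pp _ p2) => //.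
  by move=> j; apply: n12; apply: sL; rewrite mem_head.
by move=> p Pp; apply: CN; split; [exact: Cw|exact: submZ].
Qed.

Lemma step_iso A e i : subm A -> (forall r, A (r *: e) <-> P i r) ->
  induces_iso (fun r : R^o => (r : R) *: e) fullm (P i) (spanm A [:: e]) A.
Proof.
move=> sA eP; split.
- by move=> a x y; rewrite scalerDl -scalerA.
- by move=> r _; exists r, 0; rewrite add0r; split=> //; apply: subm0.
- by move=> r _; apply: eP.
- by move=> w [r [u [Au ->]]]; exists r, u; rewrite addrC.
Qed.

Lemma pfilt_noeth L A B : (forall j, j \in L -> primes (P j)) -> subm A ->
  pfilt L A B -> noethp B A.
Proof.
elim: L A => [|i L IH] A pL sA /=; first by move=> ->; apply: noethp_refl.
move=> [e [eP pB]]; have sC := spanm_subm [:: e] sA.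
have [iP _ _] := pL i (mem_head _ _).
apply: (noethp_trans sA sC).
  by apply: IH => // j jL; apply: pL; rewrite inE jL orbT.
apply: (noethp_iso _ _ sA _ (step_iso sA eP)) => //.
exact: noethp_ideal.
Qed.

Lemma pfilt_supp L A B p : (forall j, j \in L -> primes (P j)) -> subm A ->
  pfilt L A B ->
  suppm B A p <-> primes p /\ exists i, i \in L /\ sub (P i) p.
Proof.
elim: L A => [|i L IH] A pL sA /=.
  move=> ->; split; last by case=> _ [i []].
  case=> -[ip np1 pp] [x [Bx nx]].
  by case: (nx 1 np1); rewrite scale1r.
move=> [e [eP pB]]; have sC := spanm_subm [:: e] sA.
have AC := @sub_spanm _ _ A [:: e].
have [sB CB] := pfilt_sub sC pB.
have {}IH : suppm B (spanm A [:: e]) p <-> primes p /\ exists i, i \in L /\ sub (P i) p.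
  by apply: IH => // j jL; apply: pL; rewrite inE jL orbT.
split=> [[pp [x [Bx nx]]]|[pp [j [+ jp]]]].
  split=> //.
  (* At [p], either [x] falls into the first step, whose prime is then inside [p], or it survives in
     the quotient by it. *)
  have [[t [nt Ct]]|nC] := pselect (exists t, ~ p t /\ spanm A [:: e] (t *: x)).
    exists i; split; first exact: mem_head.
    move=> q Pq; apply: contrapT => nq; apply: (nx (q * t)); first exact: primeN.
    case: Ct => r [u [Au tE]]; rewrite -scalerA tE.
    have -> : q *: (u + r *: e) = q *: u + r *: (q *: e) by mring.
    by apply: submD => //; apply: submZ => //; apply/eP.
  have [|_ [j [jL jp]]] := IH.1.
    split=> //; exists x; split=> // s ns Cs; apply: nC; by exists s.
  by exists j; rewrite inE jL orbT.
rewrite inE => /orP[/eqP ji|jL].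
  split=> //; exists e; split.
    by apply: CB; exists 1, 0; rewrite scale1r add0r; split=> //; apply: subm0.
  by move=> s ns /eP; rewrite -ji => /jp.
have [|_ [x [Bx nx]]] := IH.2; first by split=> //; exists j.
by split=> //; exists x; split=> // s /nx ns /AC.
Qed.

Lemma pfilt_dep n L A B : (forall j, j \in L -> good j /\ chains j n) ->
  subm A -> pfilt L A B -> dep m n B A.
Proof.
have [im nm1 _] := pm.
elim: L A => [|i L IH] A gL sA /=.
  (* On the zero quotient the element 0 is regular and reduction changes nothing. *)
  move=> <-; elim: n {gL} => //= n IH.
  exists 0; split=> //; first exact: ideal0.
  have -> : red 0 A A = A; last exact: IH.
  apply: sub_eq; last exact: sub_red.
  by move=> _ [a [b [Aa Ab ->]]]; rewrite scale0r addr0.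
move=> [e [eP pB]]; have sC := spanm_subm [:: e] sA.
have AC : sub A (spanm A [:: e]) := @sub_spanm _ _ A [:: e].
have [sB CB] := pfilt_sub sC pB.
have gp j : j \in i :: L -> primes (P j) by case/gL => -[].
have gL' j : j \in L -> good j /\ chains j n.
  by move=> jL; apply: gL; rewrite inE jL orbT.
have E : addm (spanm A [:: e]) A = spanm A [:: e].
  apply: sub_eq => [_ [a [c [Aa Cc ->]]]|v Cv].
    by apply: submD => //; apply: AC.
  by exists v, 0; rewrite addr0; split=> //; apply: subm0.
have [[[iP nP1 PP] HP dP] ci] := gL i (mem_head _ _).
apply: (dep_extension nR im sC sA sB sA CB); rewrite ?E //.
- apply: (noethp_iso _ _ sA _ (step_iso sA eP)) => //.
  exact: noethp_ideal.
- apply: (pfilt_noeth _ sC pB) => j jL.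
  by apply: gp; rewrite inE jL orbT.
- apply/(dep_iso _ _ _ _ sC sA (step_iso sA eP)) => //.
  exact: dP.
- exact: IH.
Qed.

Lemma group_dim L : sorted dim_le L -> exists Ls,
  [/\ flatten Ls = L, forall L1, L1 \in Ls -> L1 != [::],
      forall L1, L1 \in Ls -> forall i j, i \in L1 -> j \in L1 -> dim_le i j
    & sorted (fun L1 L2 => ~~ dim_le (head 0%N L2) (head 0%N L1)) Ls].
Proof.
have refl i : dim_le i i by apply/asboolP.
elim: L => [|i L IH] sL; first by exists [::].
have [|[|L1 Ls] [fL nLs cLs sLs]] := IH; first exact: path_sorted sL.
  exists [:: [:: i]]; rewrite -fL; split=> // L1; rewrite inE => /eqP -> //.
  by move=> j k; rewrite !inE => /eqP -> /eqP ->.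
have := nLs _ (mem_head _ _); case: L1 => // j L1 in fL nLs cLs sLs * => _.
have ij : dim_le i j by move: sL; rewrite -fL /= => /andP[].
have [ji|nji] := boolP (dim_le j i).
  exists ((i :: j :: L1) :: Ls); split.
  - by rewrite /= in fL *; rewrite fL.
  - move=> L2; rewrite inE => /orP[/eqP -> //|L2s].
    by apply: nLs; rewrite inE L2s orbT.
  - move=> L2; rewrite inE => /orP[/eqP -> |L2s]; last first.
      by apply: cLs; rewrite inE L2s orbT.
    have toj k : k \in [:: i, j & L1] -> dim_le k j /\ dim_le j k.
      rewrite inE => /orP[/eqP -> //|kL].
      by split; apply: (cLs (j :: L1)); rewrite ?mem_head.
    by move=> k l /toj[kj _] /toj[_ jl]; apply: dim_le_trans kj jl.
  - case: Ls sLs {fL nLs cLs} => //= L2 Ls /andP[n2 ->]; rewrite andbT.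
    apply: contraNN n2 => li; exact: dim_le_trans li ij.
exists ([:: i] :: (j :: L1) :: Ls); split.
- by rewrite /= in fL *; rewrite fL.
- by move=> L2; rewrite inE => /orP[/eqP -> //|]; apply: nLs.
- move=> L2; rewrite inE => /orP[/eqP -> |]; last exact: cLs.
  by move=> k l; rewrite !inE => /eqP -> /eqP ->.
- by rewrite /= nji.
Qed.

Lemma pfilt_flatten Ls A B : pfilt (flatten Ls) A B ->
  exists N : nat -> V -> Prop, [/\ N 0%N = A, N (size Ls) = B,
    forall i, (i < size Ls)%N -> pfilt (nth [::] Ls i) (N i) (N i.+1)
  & forall i, (i <= size Ls)%N ->
      pfilt (flatten (take i Ls)) A (N i) /\ pfilt (flatten (drop i Ls)) (N i) B].
Proof.
elim: Ls A => [|L Ls IH] A /=.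
  by move=> AB; exists (fun=> A); split=> //= i.
rewrite pfilt_cat => -[C [pC /IH[N [N0 NB Ns Nd]]]].
exists (fun i => if i is j.+1 then N j else A); split=> //.
  by case=> [_|i /Ns //]; rewrite N0.
case=> [_|i /Nd[pi di]] /=.
  by split=> //; apply/pfilt_cat; exists C; split=> //; have [] := Nd 0%N isT; rewrite drop0 N0.
by split=> //; apply/pfilt_cat; exists C.
Qed.

(** Only dim <= depth is recorded; [wregs_chain] gives the converse. *)
Definition CM_pair B A := forall n, chainS (suppm B A) n ->
  exists xs, [/\ size xs = n, forall x, x \in xs -> m x & wregs xs B A].

Lemma pfilt_chains L A B n : (forall j, j \in L -> primes (P j)) -> subm A ->
  pfilt L A B -> chainS (suppm B A) n <-> exists i, i \in L /\ chains i n.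
Proof.
move=> pL sA pB; split=> [[Q [QS QQ]]|[i [iL ci]]].
  have [_ [i [iL iQ]]] := (pfilt_supp (Q 0%N) pL sA pB).1 (QS 0%N isT).
  exists i; split=> //; exists Q; split=> // k kn.
  split; first by case: (QS k kn).
  elim: k kn => [//|k IH] kn x /(IH (ltnW kn)).
  by case: (QQ k kn) => H' _; apply: H'.
apply: chain_sub ci => p [pp ip]; apply/(pfilt_supp p pL sA pB).
by split=> //; exists i.
Qed.

Lemma pfilt_CM L A B : (forall j, j \in L -> good j) ->
  (forall i j, i \in L -> j \in L -> dim_le i j) -> subm A -> pfilt L A B ->
  CM_pair B A.
Proof.
move=> gL cL sA pB n; have pL j : j \in L -> primes (P j) by case/gL.
move/(pfilt_chains n pL sA pB) => [i [iL ci]].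
have [sB AB] := pfilt_sub sA pB.
apply: (dep_wregs pm sA sB AB).
- exact: pfilt_noeth pB.
- apply/(pfilt_supp m pL sA pB); split=> //; exists i; split=> //.
  exact/good_sub/gL.
- apply: pfilt_dep pB => // j jL; split; first exact: gL.
  by have /asboolP := cL i j iL jL; apply.
Qed.

Theorem pretty_filtration L : (forall j, j \in L -> good j) ->
  pairwise pretty L -> pfilt L zerom fullm ->
  exists (s : nat) (N : nat -> V -> Prop),
  [/\ N 0%N = zerom /\ N s = fullm,
      forall i, (i <= s)%N -> subm (N i),
      forall i, (i < s)%N -> sub (N i) (N i.+1) /\ CM_pair (N i.+1) (N i),
      forall i, (i.+1 < s)%N ->
        exists n, chainS (suppm (N i.+2) (N i.+1)) n /\
                  ~ chainS (suppm (N i.+1) (N i)) n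
    & forall i, (i <= s)%N -> exists L',
        {subset L' <= L} /\ forall v, N i v <-> kill L' zerom v].
Proof.
move=> gL prL pL; have s0 := @zerom_subm R V.
have [L1 [perm sL1 pL1]] := pfilt_sort gL s0 prL pL.
have [Ls [fLs nLs cLs sLs]] := group_dim sL1.
rewrite -fLs in pL1 sL1 perm.
have [N [N0 Ns Nstep Nd]] := pfilt_flatten pL1.
have gLs i : i \in flatten Ls -> good i by rewrite (perm_mem perm); apply: gL.
have sN i : (i <= size Ls)%N -> subm (N i).
  by move=> /Nd[/(pfilt_sub s0)[]].
have nthLs i : (i < size Ls)%N -> {subset nth [::] Ls i <= flatten Ls}.
  by move=> iLs j ji; apply/flattenP; exists (nth [::] Ls i) => //; apply: mem_nth.
have head_in (L' : seq nat) : L' != [::] -> head 0%N L' \in L'.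
  by case: L' => //= k L'; rewrite mem_head.
have Lsep i L2 L3 : L2 \in take i Ls -> L3 \in drop i Ls ->
    ~~ dim_le (head 0%N L3) (head 0%N L2).
  move: sLs; rewrite sorted_pairwise; last first.
    move=> L4 L5 L6 n54 n46; apply: contraNN n54 => n65.
    have /orP[/(dim_le_trans n65)|] := dim_le_total (head 0%N L5) (head 0%N L4).
      by rewrite (negbTE n46).
    by [].
  rewrite -{1}(cat_take_drop i Ls) pairwise_cat => /andP[/allrelP Lr _] L2s L3s.
  exact: Lr.
exists (size Ls), N; split=> //.
- move=> i iLs; split; first by case: (pfilt_sub (sN i (ltnW iLs)) (Nstep i iLs)).
  apply: (pfilt_CM _ _ (sN i (ltnW iLs)) (Nstep i iLs)).
    by move=> j /(nthLs i iLs)/gLs.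
  by apply: cLs; apply: mem_nth.
- move=> i iLs; have iLs' := ltnW iLs; have iLs'' := ltnW iLs'.
  have /(sortedP [::])/(_ i iLs) := sLs; set n1 := head _ _; set n0 := head _ _ => n10.
  have [n [c1 c0]] : exists n, chains n1 n /\ ~ chains n0 n.
    apply: contrapT => nn; move/negP: n10; apply; apply/asboolP => n c1.
    by apply: contrapT => c0; apply: nn; exists n.
  have pL' k j : (k < size Ls)%N -> j \in nth [::] Ls k -> primes (P j).
    by move=> kLs /(nthLs k kLs)/gLs[].
  exists n; split.
    apply/(pfilt_chains n (pL' i.+1 ^~ iLs) (sN _ iLs') (Nstep _ iLs)).
    by exists n1; split=> //; apply/head_in/nLs/mem_nth.
  move/(pfilt_chains n (pL' i ^~ iLs') (sN _ iLs'') (Nstep _ iLs')) => [k [ki ck]].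
  apply: c0; have /asboolP : dim_le k n0; last by apply.
  by apply: (cLs (nth [::] Ls i)); [exact: mem_nth| |exact/head_in/nLs/mem_nth].
- move=> i iLs; exists (flatten (take i Ls)); have [p1 p2] := Nd i iLs.
  have flt : flatten Ls = flatten (take i Ls) ++ flatten (drop i Ls).
    by rewrite -flatten_cat cat_take_drop.
  split.
    by move=> j ji; rewrite -(perm_mem perm) flt mem_cat ji.
  move=> v; split; first exact: (pfilt_killed s0 p1).
  apply: (killE s0 p1 p2) => //.
    by move=> j ji; have [] := gLs j; rewrite // flt mem_cat ji orbT.
  (* An inclusion of [P k] in [P j] would make the dimension of the later group at most that of the
     earlier one. *)
  move=> k j /flattenP[L2 L2s kL2] /flattenP[L3 L3s jL3] kj.
  have /negP := Lsep i _ _ L2s L3s; apply.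
  have L2Ls : L2 \in Ls by rewrite -(cat_take_drop i Ls) mem_cat L2s.
  have L3Ls : L3 \in Ls by rewrite -(cat_take_drop i Ls) mem_cat L3s orbT.
  apply: (dim_le_trans (y := j)); first exact/(cLs L3)/jL3/head_in/nLs.
  apply: (dim_le_trans (y := k)); last exact/(cLs L2)/head_in/nLs.
  by apply/asboolP => n; apply: over_sub.
Qed.
End PrimeFiltrations.

(** * Translation to quotient modules *)

Section SubmoduleOfSet.
Variables (R : pzRingType) (V : lmodType R) (U : V -> Prop).
Hypothesis sU : U 0 /\ forall a x y, U x -> U y -> U (a *: x + y).

Definition pred_of_set : {pred V} := [pred x | `[< U x >]].

Lemma pred_of_set_closed : submod_closed pred_of_set.
Proof.
case: sU => U0 UP; split=> [|a x y /asboolP Ux /asboolP Uy]; apply/asboolP => //.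
exact: UP.
Qed.

HB.instance Definition _ :=
  GRing.isSubmodClosed.Build R V pred_of_set pred_of_set_closed.

Definition submod_of : submodClosed V := pred_of_set.

Lemma mem_submod_of x : x \in submod_of <-> U x.
Proof. by split=> [/asboolP|Ux]; last apply/asboolP. Qed.
End SubmoduleOfSet.

Section Interface.
Variable R : comNzRingType.
Implicit Types (V W N : lmodType R) (P : ideal R) (m : ideal R).

Definition setm V (N : submodClosed V) : V -> Prop := fun v => v \in N.
Definition seti P : R -> Prop := fun r => (r : R^o) \in P.

Lemma setm_subm V (N : submodClosed V) : subm (setm N).
Proof.
split; first exact: rpred0.
by move=> a x y Nx Ny; apply: rpredD => //; apply: rpredZ.
Qed.

Lemma seti_ideal P : is_ideal (seti P).
Proof. exact: (setm_subm P). Qed.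

Lemma setm_submod_of V (U : V -> Prop) (sU : subm U) : setm (submod_of sU) = U.
Proof. by apply: sub_eq => x; rewrite /setm mem_submod_of. Qed.

Lemma primesP P : is_prime P <-> primes (seti P).
Proof.
split=> [[P1 PP]|[iP nP1 PP]].
  split; [exact: seti_ideal|exact/negP|].
  by move=> a b /PP /orP.
split; first exact/negP.
by move=> a b /PP ab; apply/orP.
Qed.

Lemma quot_pi_lin V (N : submodClosed V) : lin (@quot_pi R V N).
Proof. by move=> a x y; rewrite quot_piD -quot_piZ. Qed.

Lemma quot_pi_eq0 V (N : submodClosed V) x : quot_pi N x = 0 <-> x \in N.
Proof.
rewrite -(lin0 (quot_pi_lin N)).
split=> [/eqP|Nx].
  by rewrite /quot_pi -Quotient.idealrBE subr0.
by apply/eqP; rewrite /quot_pi -Quotient.idealrBE subr0.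
Qed.

Lemma noetherian_noethR : noetherian R -> noethR R.
Proof.
move=> nR U sU _; have [n [g gP]] := nR (submod_of sU).
exists [seq sub_val (g i) | i <- enum 'I_n]; split.
  move=> _ /mapP[i _ ->]; apply/(mem_submod_of sU); exact: (sub_valP (g i)).
move=> x Ux; have xU : (x : R^o) \in submod_pred (submod_of sU).
  exact/(mem_submod_of sU).
have [c xE] := gP (SubOf xU).
rewrite -[x]/(sub_val (SubOf xU)) xE.
rewrite (big_morph (@sub_val R R^o (submod_of sU)) (id1 := 0) (op1 := +%R)) //.
have s0 := spanm_subm [seq sub_val (g i) | i <- enum 'I_n] (@zerom_subm R R^o).
apply: (subm_sum s0) => i _; apply: (submZ s0); apply: spanm_mem.
  exact: zerom_subm.
by apply: map_f; rewrite mem_enum.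
Qed.

(* N is isomorphic to B / A, via a common cover W. *)
Definition presents V (B A : V -> Prop) N :=
  exists (W : lmodType R) (f : W -> V) (g : W -> N),
  [/\ lin f, lin g, forall x, exists w, x = g w
    & [/\ forall w, B (f w), forall b, B b -> exists w, b = f w
        & forall w, g w = 0 <-> A (f w)]].

Lemma presents_quotmod V (N : submodClosed V) :
  presents fullm (setm N) (quotmod N).
Proof.
exists V, id, (@quot_pi R V N); split=> //.
- exact: quot_pi_lin.
- by move=> x; have [y ->] := quot_piP x; exists y.
- split=> // [b _|w]; first by exists b.
  exact: quot_pi_eq0.
Qed.

Lemma presents_subquot V (B A : submodClosed V) :
  presents (setm B) (setm A) (subquot B A).
Proof.
exists (sub_of B), (@sub_val R V B), (quot_pi (@trace_pred R V B A)); split=> //.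
- exact: quot_pi_lin.
- by move=> x; have [y ->] := quot_piP x; exists y.
- split=> [w|b Bb|w]; first exact: (sub_valP w).
    by exists (SubOf (Bb : b \in submod_pred B)).
  by rewrite quot_pi_eq0.
Qed.

Lemma presents_self V : presents fullm (@zerom R V) V.
Proof.
exists V, id, id; split=> // [x|]; first by exists x.
by split=> // b _; exists b.
Qed.

Lemma presents_red V (B A : V -> Prop) N x :
  presents B A N -> presents B (red x B A) (quotmod (@smul_pred R N x)).
Proof.
move=> [W [f [g [fl gl gs [fB Bf gA]]]]].
exists W, f, (fun w => quot_pi (@smul_pred R N x) (g w)); split=> //.
- by move=> a u v; rewrite gl quot_pi_lin.
- by move=> y; have [z ->] := quot_piP y; have [w ->] := gs z; exists w.
split=> // w; rewrite quot_pi_eq0; split.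
  move=> /asboolP[y]; have [w' ->] := gs y => E.
  exists (f (w - x *: w')), (f w'); split=> //.
    by apply/gA; rewrite (linB gl) (linZ gl) E subrr.
  by rewrite (linB fl) (linZ fl) subrK.
move=> [a [b [Aa /Bf[w' ->] E]]]; apply/asboolP; exists (g w').
apply/eqP; rewrite -subr_eq0; apply/eqP.
rewrite -(linZ gl) -(linB gl); apply/gA.
by rewrite (linB fl) (linZ fl) E addrK.
Qed.

Lemma presents_regular V (B A : V -> Prop) N xs :
  presents B A N -> regular_seq xs N <-> wregs xs B A.
Proof.
elim: xs N A => [|x xs IH] N A pN /=.
  have [W [f [g [fl gl gs [fB Bf gA]]]]] := pN.
  split=> [[y]|[b [/Bf[w ->] nA]]].
    have [w ->] := gs y => /eqP gw; exists (f w); split=> //.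
    by move/gA/gw.
  by exists (g w); apply/eqP => /gA.
rewrite (IH _ _ (presents_red x pN)).
have [W [f [g [fl gl gs [fB Bf gA]]]]] := pN.
suff -> : (forall y : N, x *: y = 0 -> y = 0) <-> regm B A x by [].
split=> [H b /Bf[w ->]|H y].
  by rewrite -(linZ fl) => /gA; rewrite (linZ gl) => /H /gA.
have [w ->] := gs y; rewrite -(linZ gl) => /gA; rewrite (linZ fl).
by move=> /H Hw; apply/gA/Hw.
Qed.

Lemma presents_supp V (B A : V -> Prop) N P :
  presents B A N -> supp N P <-> suppm B A (seti P).
Proof.
move=> [W [f [g [fl gl gs [fB Bf gA]]]]].
rewrite /supp /suppm primesP; split=> -[pP [x Hx]]; split=> //.
  have [w xE] := gs x; exists (f w); split=> // s /negP /Hx /eqP.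
  rewrite xE -(linZ gl) -(linZ fl) => H /gA; exact: H.
have [Bx {}Hx] := Hx; have [w xE] := Bf x Bx.
exists (g w) => s /negP /Hx; rewrite xE -(linZ fl) -(linZ gl) => H.
by apply/eqP => /gA.
Qed.

Lemma presents_chain V (B A : V -> Prop) N n :
  presents B A N -> supp_chain N n <-> chainS (suppm B A) n.
Proof.
move=> pN; split=> [[P [PS PP]]|[P [PS PP]]].
  exists (fun i => seti (P i)); split=> [i /PS|i /PP //].
  by rewrite (presents_supp _ pN).
(* Beyond index [n] nothing is known of [P i]; the zero ideal serves as default. *)
pose Q i : ideal R := match pselect (is_ideal (P i)) with
  | left h => @submod_of R R^o (P i) h | right _ => submod_of (@zerom_subm R R^o) end.
have QE i : (i <= n)%N -> seti (Q i) = P i.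
  move=> /PS[[iP _ _] _]; rewrite /Q; case: pselect => // h.
  exact: (@setm_submod_of R^o (P i) h).
exists Q; split=> i iL.
  by rewrite (presents_supp _ pN) QE //; apply: PS.
have := PP i iL; rewrite -(QE i.+1) // -(QE i) //; exact: ltnW.
Qed.

Lemma presents_depth V (B A : V -> Prop) N m : presents B A N ->
  depth m N = sup_nat (fun n => exists xs,
    [/\ size xs = n, forall x, x \in xs -> seti m x & wregs xs B A]).
Proof.
move=> pN; congr sup_nat; apply/funext => n; apply/propext.
by split=> -[xs [sxs mxs rxs]]; exists xs; split=> //; apply/(presents_regular xs pN).
Qed.

Lemma presents_dim V (B A : V -> Prop) N : presents B A N ->
  krull_dim N = sup_nat (chainS (suppm B A)).
Proof.
move=> pN; congr sup_nat; apply/funext => n; apply/propext.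
exact: presents_chain.
Qed.
End Interface.

(** * Suprema of initial segments of the naturals *)

Section SupNat.
Implicit Types A B : nat -> Prop.

Definition down A := forall k n, (k <= n)%N -> A n -> A k.

(** A downward closed set is determined by its supremum, also for the values -oo and +oo; equalities
    of depth and dimension thereby become equalities of sets. *)
Lemma sup_natP A n : down A -> A n <-> (n%:Z%:E <= sup_nat A)%E.
Proof.
move=> dA; rewrite /sup_nat; case: asboolP => [->|nA0]; first by split.
case: asboolP => [ex|nex].
  have := xgetPex 0%N ex; move: (xget _ _) => l [Al lmax].
  rewrite lee_fin lez_nat; split; first exact: lmax.
  by move=> nl; apply: dA Al.
split=> // _.
apply: contrapT => nAn; have [k Ak] : exists k, A k.
  apply: contrapT => nA; apply: nA0; apply/funext => k; apply/propext.
  by split=> // Ak; apply: nA; exists k.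
have bound l : `[< A l >] -> (l <= n)%N.
  by move=> /asboolP Al; rewrite leqNgt; apply/negP => /ltnW nl; apply/nAn/dA/Al.
have exA : exists k, `[< A k >] by exists k; apply/asboolP.
case: (ex_maxnP exA bound) => l /asboolP Al lmax.
by apply: nex; exists l; split=> // j /asboolP; apply: lmax.
Qed.

Lemma sup_nat_inj A B : down A -> down B -> sup_nat A = sup_nat B -> A = B.
Proof.
move=> dA dB E; apply/funext => n; apply/propext.
by rewrite (sup_natP n dA) E -sup_natP.
Qed.

Lemma sup_nat_lt A B n : down A -> down B -> B n -> ~ A n ->
  (sup_nat A < sup_nat B)%E.
Proof.
move=> dA dB /(sup_natP n dB) nB nA; apply: lt_le_trans nB.
by rewrite ltNge; apply/negP => /(sup_natP n dA).
Qed.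
End SupNat.

Lemma chainS_down (R : comNzRingType) (S : (R -> Prop) -> Prop) : down (chainS S).
Proof. by move=> k n; apply: chainW. Qed.

(** * Cohen-Macaulay quotients and prime filtrations as predicates *)

Section CohenMacaulay.
Variables (R : comNzRingType) (m : ideal R).
Hypothesis nR : noethR R.

Definition regular_lengths (V : lmodType R) (B A : V -> Prop) (n : nat) :=
  exists xs, [/\ size xs = n, forall x, x \in xs -> seti m x & wregs xs B A].

Lemma wregs_cat (V : lmodType R) xs ys (B A : V -> Prop) : subm A -> subm B ->
  wregs (xs ++ ys) B A -> wregs xs B A.
Proof.
elim: xs A => [|x xs IH] A sA sB /=; last first.
  by move=> [rx /(IH _ (red_subm x sA sB) sB)].
elim: ys A sA => [//|y ys IHy] A sA /= [_ /IHy[|b [Bb nb]]]; first exact: red_subm.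
by exists b; split=> // /(@sub_red _ _ y B A sB).
Qed.

Lemma regular_lengths_down (V : lmodType R) (B A : V -> Prop) :
  subm A -> subm B -> down (regular_lengths B A).
Proof.
move=> sA sB k n kn [xs [sxs mxs rxs]]; exists (take k xs); split.
- by rewrite size_take sxs; case: ltngtP kn.
- by move=> x /mem_take /mxs.
- by apply: (@wregs_cat _ _ (drop k xs)); rewrite ?cat_take_drop.
Qed.

Lemma CM_presents (V : lmodType R) (B A : V -> Prop) (N : lmodType R) :
  subm A -> subm B -> sub A B -> presents B A N ->
  CM m N <-> CM_pair (seti m) B A.
Proof.
move=> sA sB AB pN; rewrite /CM (presents_depth _ pN) (presents_dim pN).
rewrite -/(regular_lengths B A); split=> [E n|H].
  by rewrite -(sup_nat_inj (regular_lengths_down sA sB) (@chainS_down _ _) E).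
congr sup_nat; apply: sub_eq => n; last exact: H.
by move=> [xs [<- _ rxs]]; apply: wregs_chain rxs.
Qed.

Lemma suppm_over (P : ideal R) p : is_prime P ->
  @suppm R R^o fullm (seti P) p <-> over (seti P) p.
Proof.
move=> /primesP pP; split=> [[pp [x [_ Hx]]]|[pp Pp]].
  split=> // r Pr; apply: contrapT => /Hx; apply.
  exact: (idealMr (seti_ideal P) x Pr).
split=> //; exists 1; split=> // s ns; rewrite [_ *: _]mulr1.
by move=> /Pp.
Qed.

Lemma chain_quot (P : ideal R) n : is_prime P ->
  chainS (@suppm R R^o fullm (seti P)) n <-> chainS (over (seti P)) n.
Proof. by move=> pP; split; apply: chain_sub => p /(suppm_over _ pP). Qed.

Lemma CM_depR (P : ideal R) n : is_prime P -> CM m (quotmod P) ->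
  chainS (over (seti P)) n -> depR (seti m) n (seti P).
Proof.
move=> pP /(CM_presents (setm_subm P) (@fullm_subm _ _) (fun _ _ => I)
  (presents_quotmod P)) H /(chain_quot _ pP)/H[xs [<- mxs rxs]].
exact: dep_of_wregs.
Qed.

Lemma krull_dim_quot (P : ideal R) : is_prime P ->
  krull_dim (quotmod P) = sup_nat (chainS (over (seti P))).
Proof.
move=> pP; rewrite (presents_dim (presents_quotmod P)).
by congr sup_nat; apply: sub_eq => n /(chain_quot _ pP).
Qed.

(** The generator is a lift to [B] of the class corresponding to 1 in R/P. *)
Lemma step_generator (V : lmodType R) (A B : submodClosed V) (P : ideal R) :
  {subset A <= B} -> lin_iso (subquot B A) (quotmod P) ->
  exists e, (forall r, setm A (r *: e) <-> seti P r) /\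
            spanm (setm A) [:: e] = setm B.
Proof.
move=> AB [f [g fK gK]].
pose pi := quot_pi (@trace_pred R V B A).
have pil : lin pi := quot_pi_lin _.
have [x xE] := quot_piP (g (quot_pi P (1 : R^o))).
have fx r : f (pi (r *: x)) = quot_pi P (r : R^o).
  rewrite (linZ pil) linearZ /= /pi -xE gK.
  rewrite -(linZ (quot_pi_lin P)); congr quot_pi; exact: mulr1.
have f0 y : f (pi y) = 0 <-> setm A (sub_val y).
  have <- : pi y = 0 <-> setm A (sub_val y) := quot_pi_eq0 (@trace_pred R V B A) y.
  split=> [E|->]; last exact: linear0.
  by apply: (can_inj fK); rewrite E linear0.
exists (sub_val x); split.
  move=> r; rewrite -[r *: _]/(sub_val (r *: x)) -f0 fx; exact: quot_pi_eq0.
apply: sub_eq => v.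
  move=> [r [u [Au ->]]]; apply: (submD (setm_subm B)); first exact: AB.
  apply: (submZ (setm_subm B)); exact: (sub_valP x).
move=> Bv; pose y := SubOf (Bv : v \in submod_pred B).
have [r rE] := quot_piP (f (pi y)).
exists r, (v - r *: sub_val x); split; last by rewrite subrK.
have : f (pi (y - r *: x)) = 0.
  by rewrite (linB pil) raddfB /= fx -rE subrr.
by move/f0.
Qed.

Lemma pfilt_prime (V : lmodType R) r (F : nat -> submodClosed V)
    (P : nat -> ideal R) : prime_filtration r F P ->
  pfilt (fun i => seti (P i)) (iota 0 r) zerom (@fullm R V).
Proof.
move=> [[F0 Fr FS] FP].
have -> : @zerom R V = setm (F 0%N).
  by apply: sub_eq => v; [move=> ->; exact: rpred0|rewrite /setm F0 => /eqP].
have -> : @fullm R V = setm (F r) by apply: sub_eq => v // _; apply: Fr.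
suff H k i : (i + k <= r)%N ->
    pfilt (fun j => seti (P j)) (iota i k) (setm (F i)) (setm (F (i + k)%N)).
  exact: (H r 0%N).
elim: k i => [|k IH] i /=; first by rewrite addn0.
rewrite addnS => ikr; have ir : (i < r)%N by apply: leq_trans ikr; rewrite ltnS leq_addr.
have [_ /(step_generator (FS i ir))[e [eP eE]]] := FP i ir.
exists e; split=> //; have := IH i.+1; rewrite -eE addSn; apply; exact: ikr.
Qed.
End CohenMacaulay.

(** * Local rings *)

(** Take an ideal J in m maximal among those with R/J of unbounded depth, and x in m regular modulo
    J. By [dep_red] the ideal J + (x) has the same property, so x is in J; regularity then puts 1 in
    J. *)
Lemma depR_bounded (R : comNzRingType) (m I : R -> Prop) :
  noethR R -> primes m -> is_ideal I -> sub I m -> ~ forall n, depR m n I.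
Proof.
move=> nR pm iI Im dI; have [im nm1 _] := pm.
have [||J [[iJ Jm dJ] Jmax]] := @noeth_max R
  (fun J => [/\ is_ideal J, sub J m & forall n, depR m n J]) I nR.
- by split.
- by move=> J [].
have [x [mx rx _]] := dJ 1%N.
have nJ := noethp_ideal nR iJ.
apply: (nm1); apply: (Jm); apply: (rx 1) => //; rewrite [_ *: _]mulr1.
apply: (Jmax (add_gen J x)); last exact: add_gen_mem.
  split; first exact: add_gen_ideal.
    move=> _ [r [u [Ju ->]]]; apply: idealD => //; first exact: Jm.
    exact: idealM.
  move=> n; rewrite /depR -red_add_gen.
  exact: (@dep_red R R^o nR m n fullm J x im iJ (@fullm_subm _ _) nJ (dJ n.+1)).
exact: sub_add_gen.
Qed.

Section LocalClass.
Variables (R : comNzRingType) (m : ideal R) (H : (R -> Prop) -> Prop)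
  (h : R -> Prop).
Hypotheses (nR : noethR R) (pm : primes (seti m)) (lc : local_class (seti m) H h).
Variables (M : lmodType R) (r : nat) (F : nat -> submodClosed M)
  (P : nat -> ideal R).
Hypotheses (pcF : pretty_clean_filtration r F P)
  (cmP : forall i, (i < r)%N -> CM m (quotmod (P i)))
  (HP : forall i, (i < r)%N -> H (seti (P i))).

Let p i := seti (P i).

Lemma prime_step i : (i < r)%N -> is_prime (P i).
Proof. by case: pcF => -[_ FP] _ /FP[]. Qed.

Lemma good_step i : i \in iota 0 r -> good (seti m) H p i.
Proof.
rewrite mem_iota add0n /= => ir; split; [by apply/primesP; apply: prime_step|exact: HP|].
by move=> n; apply: (CM_depR nR (prime_step ir)); exact: cmP.
Qed.

Lemma pfilt_full : pfilt p (iota 0 r) zerom (@fullm R M).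
Proof. exact: pfilt_prime pcF.1. Qed.

Lemma pretty_iota : pairwise (pretty p) (iota 0 r).
Proof.
apply/(pairwiseP 0%N) => i j; rewrite !inE size_iota => ir jr ij.
rewrite !nth_iota // !add0n; apply/asboolP => /(pcF.2 i j ij jr) E.
by move=> n; apply: over_sub => x; rewrite /p /seti E.
Qed.

Lemma class_seq_CM (adm : submodClosed M -> Prop) :
  (forall (L : seq nat) (N : submodClosed M),
     (forall i, i \in L -> (i < r)%N) ->
     (forall v, v \in N <-> kill p L zerom v) -> adm N) ->
  seq_CM_among m adm.
Proof.
move=> admP.
have [s [N [[N0 Ns] sN NS Nlt Nk]]] :=
  pretty_filtration nR pm lc good_step pretty_iota pfilt_full.
pose N' i : submodClosed M := match pselect (subm (N i)) with
  | left sNi => submod_of sNi | right _ => submod_of (@zerom_subm R M) end.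
have N'E i : (i <= s)%N -> setm (N' i) = N i.
  by move=> /sN sNi; rewrite /N'; case: pselect => // h'; apply: setm_submod_of.
have mN' i v : (i <= s)%N -> v \in N' i <-> N i v.
  by move=> /N'E <-.
exists s, N'; split.
- split.
  + move=> v; apply/idP/eqP => [/(mN' _ _ (leq0n s))|v0]; first by rewrite N0.
    by apply/(mN' _ _ (leq0n s)); rewrite N0.
  + by move=> v; apply/(mN' _ _ (leqnn s)); rewrite Ns.
  + move=> i ir v /(mN' _ _ (ltnW ir)) Nv; apply/(mN' _ _ ir).
    by case: (NS i ir) => H' _; apply: H'.
- move=> i /[dup] /Nk[L [Lr NL]] ir; apply: (admP L).
    by move=> j /Lr; rewrite mem_iota add0n.
  by move=> v; rewrite mN'.
- move=> i ir; have [NN cN] := NS i ir.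
  apply/(CM_presents m nR (setm_subm _) (setm_subm _) _ (presents_subquot _ _)).
    by rewrite !N'E //; exact: ltnW.
  by rewrite !N'E //; exact: ltnW.
- move=> i ir; have [n [n1 n0]] := Nlt i ir.
  rewrite !(presents_dim (presents_subquot _ _)) !N'E //; try by do 2?exact: ltnW.
    exact: (sup_nat_lt (@chainS_down _ _) (@chainS_down _ _) n1 n0).
  exact/ltnW/ltnW.
Qed.

Lemma class_clean_CM :
  (forall i, (i < r)%N -> krull_dim (quotmod (P i)) = krull_dim M) ->
  clean M /\ CM m M.
Proof.
move=> dimP.
have chainsE i j : (i < r)%N -> (j < r)%N -> chains p i = chains p j.
  move=> ir jr; apply: sup_nat_inj; try exact: chainS_down.
  by rewrite -!krull_dim_quot ?dimP //; apply: prime_step.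
have pP i : i \in iota 0 r -> primes (p i) by case/good_step.
have s0 := @zerom_subm R M.
split; last first.
  apply/(CM_presents m nR s0 (@fullm_subm _ _) _ (presents_self M)) => //.
  apply: (pfilt_CM nR pm lc good_step _ s0 pfilt_full) => i j.
  rewrite !mem_iota !add0n /= => ir jr.
  by apply/asboolP; rewrite (chainsE i j).
exists r, F, P; split; first by case: pcF.
move=> i ir; have iL : i \in iota 0 r by rewrite mem_iota.
split.
  apply/(presents_supp _ (presents_self M))/(pfilt_supp _ pP s0 pfilt_full).
  by split; [exact: pP|exists i; split=> // x].
move=> Q /(presents_supp _ (presents_self M)).
move=> /(pfilt_supp _ pP s0 pfilt_full)[pQ [j [jL jQ]]] QP.
have jr : (j < r)%N by rewrite mem_iota add0n in jL.
suff ij : sub (p i) (p j) by move=> x; apply/idP/idP => [/QP|/ij/jQ].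
(* Now [P j] lies strictly inside [P i], yet both have the same chain lengths. Prepending [P j]
   lengthens every chain over [P i], so chains of all lengths exist and the depth of R/P i would be
   unbounded. *)
apply: contrapT => nij; have [pi Hi di] := good_step iL.
have ji : sub (p j) (p i) by move=> x /jQ/QP.
have step n : chains p i n -> chains p i n.+1.
  move=> cn; rewrite (chainsE i j ir jr); move: cn.
  apply: chain_cons => q [pq iq]; first by split=> // x /ji/iq.
  exists (p j); split; [|by move=> x /ji/iq|by move=> qj; apply: nij => x /iq/qj].
  by split=> //; apply: pP.
have all n : chains p i n.
  by elim: n => [|n /step //]; apply: (@chain0 _ _ (p i)); split=> // x.
have [ip np1 _] := pi.
by apply: (depR_bounded nR pm ip (lc_sub lc Hi np1)) => n; apply: di.
Qed.
End LocalClass.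

Lemma colon_ideal (R : comNzRingType) (I J : R -> Prop) : is_ideal I ->
  is_ideal (fun r => forall j, J j -> I (r * j)).
Proof.
move=> iI; split=> [j _|a x y Ix Iy j Jj]; first by rewrite mul0r; apply: ideal0.
have -> : (a * x + y) * j = a * (x * j) + y * j by ring.
by apply: idealD; auto; apply: idealM; auto.
Qed.

Lemma colon_elt_ideal (R : comNzRingType) (I : R -> Prop) u : is_ideal I ->
  is_ideal (fun r => I (r * u)).
Proof.
move=> iI; split=> [|a x y Ix Iy]; first by rewrite mul0r; apply: ideal0.
have -> : (a * x + y) * u = a * (x * u) + y * u by ring.
by apply: idealD; auto; apply: idealM; auto.
Qed.

Lemma ideals_local_class (R : comNzRingType) (m : ideal R) : noethR R ->
  is_local m -> local_class (seti m) (@is_ideal R) (fun=> True).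
Proof.
move=> nR [_ mloc]; split=> //.
- move=> I iI nI1; have [||J [[iJ nJ1 IJ] Jmax]] := @noeth_max R
    (fun J => [/\ is_ideal J, ~ J 1 & sub I J]) I nR.
  + by split=> // x.
  + by move=> J [].
  have Jm : is_maximal (@submod_of R R^o J iJ).
    split; first by apply/negP => /(mem_submod_of (V := R^o) iJ).
    move=> J' J'1 JJ' x J'x; apply/(mem_submod_of (V := R^o) iJ).
    apply: (Jmax (seti J')) J'x; last first.
      by move=> y Jy; apply/JJ'/(mem_submod_of (V := R^o) iJ).
    split; [exact: seti_ideal|exact/negP|].
    by move=> y /IJ Jy; apply/JJ'/(mem_submod_of (V := R^o) iJ).
  move=> x /IJ Jx; rewrite /seti -(mloc _ Jm).
  exact/(mem_submod_of (V := R^o) iJ).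
- move=> I J _ _ nJI; apply: contrapT => H; apply: nJI => x Jx.
  by apply: contrapT => nIx; apply: H; exists x.
- by move=> I s iI _; apply: add_gen_ideal.
- by move=> I J iI _; apply: colon_ideal.
- by move=> I u iI _; apply: colon_elt_ideal.
Qed.

Lemma maximal_prime (R : comNzRingType) (m : ideal R) :
  is_maximal m -> primes (seti m).
Proof.
move=> [m1 mmax]; have im := seti_ideal m.
split=> //; first exact/negP.
move=> a b mab; have [|na] := pselect (seti m a); [by left|right].
have ia := add_gen_ideal a im.
have [[r [u [mu E]]]|n1] := pselect (add_gen (seti m) a 1).
  have -> : b = b * u + r * (a * b).
    by rewrite -[LHS]mulr1 E; ring.
  by apply: idealD => //; apply: idealM.
case: na; apply: (mmax (@submod_of R R^o _ ia)).
- by apply/negP => /(mem_submod_of (V := R^o) ia).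
- by move=> x mx; apply/(mem_submod_of (V := R^o) ia); apply: sub_add_gen.
- by apply/(mem_submod_of (V := R^o) ia); apply: add_gen_mem.
Qed.

(** * Graded rings *)

Section Components.
Variables (I : eqType) (V : zmodType) (G : I -> {pred V}).

Definition restrict (s : seq I) (c : I -> V) (i : I) := if i \in s then c i else 0.

Definition components (cmp : I -> V -> V) :=
  [/\ forall i v, cmp i v \in G i,
      forall v, exists s, [/\ uniq s, forall i, i \notin s -> cmp i v = 0
                            & v = \sum_(i <- s) cmp i v]
    & forall s c, uniq s -> (forall i, c i \in G i) ->
        forall i, cmp i (\sum_(i <- s) c i) = restrict s c i].

Lemma sum_restrict w s c : uniq w -> uniq s -> {subset s <= w} ->
  \sum_(i <- w) restrict s c i = \sum_(i <- s) c i.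
Proof.
move=> uw us sw; rewrite /restrict -big_mkcond /= -big_filter.
apply/perm_big/uniq_perm => //; first exact: filter_uniq.
by move=> i; rewrite mem_filter; case: (boolP (i \in s)) => // /sw ->.
Qed.

Hypothesis Gz : forall i, zmod_closed (G i).

Lemma restrict_mem s c : (forall i, c i \in G i) ->
  forall i, restrict s c i \in G i.
Proof. by move=> cG i; rewrite /restrict; case: ifP => // _; case: (Gz i). Qed.

Lemma components_exist : direct_sum G -> exists cmp, components cmp.
Proof.
move=> [Gs Gu].
have /choice[f Hf] : forall v, exists sc : seq I * (I -> V),
    [/\ uniq sc.1, forall i, sc.2 i \in G i & v = \sum_(i <- sc.1) sc.2 i].
  by move=> v; have [s [c Hsc]] := Gs v; exists (s, c).
exists (fun i v => restrict (f v).1 (f v).2 i); split.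
- by move=> i v; apply: restrict_mem; case: (Hf v).
- move=> v; have [us cG E] := Hf v; exists (f v).1; split=> //.
    by move=> i /negbTE; rewrite /restrict => ->.
  by rewrite (sum_restrict _ us us).
move=> s c us cG i; set v := \sum_(i <- s) c i.
have [ut dG E] := Hf v; apply/eqP; rewrite -subr_eq0; apply/eqP.
set t := (f v).1 in ut E *; set d := (f v).2 in dG E *.
have [iw|] := boolP (i \in undup (s ++ t)); last first.
  rewrite mem_undup mem_cat negb_or => /andP[/negbTE ns /negbTE nt].
  by rewrite /restrict ns nt subrr.
(* Over the union of both index lists, the difference of the two decompositions is a decomposition
   of 0. *)
apply: (Gu (undup (s ++ t)) (fun j => restrict t d j - restrict s c j)) => //.
- exact: undup_uniq.
- by move=> j; case: (Gz j) => _; apply; apply: restrict_mem.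
rewrite sumrB !sum_restrict ?undup_uniq // -?E ?subrr //;
  by move=> j; rewrite mem_undup mem_cat => ->; rewrite ?orbT.
Qed.

Variable cmp : I -> V -> V.
Hypothesis cmpP : components cmp.

Lemma cmp_mem i v : cmp i v \in G i. Proof. by case: cmpP. Qed.

Lemma cmp_unique s c : uniq s -> (forall i, c i \in G i) ->
  forall i, cmp i (\sum_(i <- s) c i) = restrict s c i.
Proof. by case: cmpP => _ _; apply. Qed.

Lemma cmpB i u v : cmp i (u - v) = cmp i u - cmp i v.
Proof.
case: cmpP => _ cs _; have [s [us s0 uE]] := cs u; have [t [ut t0 vE]] := cs v.
pose w := undup (s ++ t).
have zw x s' : (forall j, j \notin s' -> cmp j x = 0) ->
    restrict s' (cmp^~ x) = cmp^~ x.
  move=> s0'; apply/funext => j; rewrite /restrict; case: ifP => // /negbT.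
  by move/s0' => ->.
have uw : uniq w by apply: undup_uniq.
have E : u - v = \sum_(j <- w) (cmp j u - cmp j v).
  have sumw x s' : uniq s' -> {subset s' <= w} ->
      (forall j, j \notin s' -> cmp j x = 0) -> x = \sum_(j <- s') cmp j x ->
      \sum_(j <- w) cmp j x = x.
    move=> us' sw z {2}->; rewrite -(sum_restrict _ uw us' sw).
    by apply: eq_bigr => j _; rewrite (zw x s' z).
  by rewrite sumrB (sumw u s) ?(sumw v t) // => j;
    rewrite mem_undup mem_cat => ->; rewrite ?orbT.
rewrite {1}E cmp_unique //; last by move=> j; case: (Gz j) => _; apply; apply: cmp_mem.
rewrite /restrict; case: ifP => // /negbT.
rewrite mem_undup mem_cat negb_or => /andP[/s0 -> /t0 ->].
by rewrite subrr.
Qed.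

Lemma cmp0 i : cmp i 0 = 0.
Proof. by have := cmpB i 0 0; rewrite !subrr. Qed.

Lemma cmpD i u v : cmp i (u + v) = cmp i u + cmp i v.
Proof. by rewrite -{1}[v]opprK cmpB -[- v]sub0r cmpB cmp0 sub0r opprK. Qed.

Lemma cmp_sum i (T : Type) (s : seq T) (Q : pred T) (F : T -> V) :
  cmp i (\sum_(j <- s | Q j) F j) = \sum_(j <- s | Q j) cmp i (F j).
Proof. exact: (big_morph (cmp i) (cmpD i) (cmp0 i)). Qed.

Lemma cmp_homog i j v : v \in G i -> cmp j v = if j == i then v else 0.
Proof.
move=> vi; have := @cmp_unique [:: i] (fun k => if k == i then v else 0).
rewrite big_seq1 eqxx => -> //; first by rewrite /restrict inE; case: eqP.
by move=> k; case: eqP => [->|] //; case: (Gz k).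
Qed.

Lemma cmp_support v : exists s, [/\ uniq s, forall i, i \notin s -> cmp i v = 0
                            & v = \sum_(i <- s) cmp i v].
Proof. by case: cmpP. Qed.
End Components.

Section GradedAction.
Variables (R : comNzRingType) (V : lmodType R) (I : eqType).
Variables (GR : nat -> {pred R}) (GV : I -> {pred V}) (tau : nat -> I -> I).
Variables (cR : nat -> R -> R) (cV : I -> V -> V).
Hypothesis GVz : forall i, zmod_closed (GV i).
Hypotheses (cRP : components GR cR) (cVP : components GV cV).
Hypothesis tau_inj : forall j, injective (tau j).
Hypothesis act : forall j i a v, a \in GR j -> v \in GV i -> a *: v \in GV (tau j i).

Definition homR (J : R -> Prop) := forall k x, J x -> J (cR k x).
Definition homV (T : V -> Prop) := forall i v, T v -> T (cV i v).

Lemma cmp_act_sum j a v k : a \in GR j -> exists s,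
  [/\ uniq s, forall i, i \notin s -> cV i v = 0
    & cV k (a *: v) = \sum_(i <- s) if k == tau j i then a *: cV i v else 0].
Proof.
move=> aj; have [s [us s0 vE]] := cmp_support cVP v; exists s; split=> //.
rewrite {1}vE scaler_sumr (cmp_sum GVz cVP); apply: eq_bigr => i _.
by rewrite (cmp_homog GVz cVP k (act aj (cmp_mem cVP i v))).
Qed.

(** [tau j] is the degree shift by [j], kept abstract to cover both [R] over itself, with degrees in
    [nat], and modules with degrees in [int]. Its injectivity leaves one contributing component of
    [v]. *)
Lemma cmp_act j a v i : a \in GR j -> cV (tau j i) (a *: v) = a *: cV i v.
Proof.
move=> aj; have [s [us s0 ->]] := cmp_act_sum v (tau j i) aj.
under eq_bigr do rewrite (inj_eq (tau_inj (j := j))).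
rewrite -big_mkcond /=; have [si|/s0 vi0] := boolP (i \in s).
  by rewrite (big_rem i) //= eqxx big1_seq ?addr0 // => k /andP[/eqP <-];
    rewrite mem_rem_uniqF.
by rewrite vi0 scaler0 big1 // => k /eqP <-; rewrite vi0 scaler0.
Qed.

(** The degree [k] may lie outside the image of [tau j], for instance below [j] in [nat]; the
    component is then 0. *)
Lemma cmp_act_ex j a v k : a \in GR j -> exists w, cV k (a *: v) = a *: w.
Proof.
move=> aj; have [s [us s0 ->]] := cmp_act_sum v k aj.
exists (\sum_(i <- s) if k == tau j i then cV i v else 0).
by rewrite scaler_sumr; apply: eq_bigr => i _; case: ifP; rewrite ?scaler0.
Qed.

Lemma hom_colon J T : subm T -> homR J -> homV T -> homV (colon J T).
Proof.
move=> sT hJ hT i v Jv p Jp; have [s [us s0 ->]] := cmp_support cRP p.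
rewrite scaler_suml; apply: (subm_sum sT) => j _.
by rewrite -(cmp_act _ _ (cmp_mem cRP j p)); apply/hT/Jv/hJ.
Qed.
End GradedAction.

Lemma seq_max (d : Order.disp_t) (T : orderType d) (s : seq T) (Q : T -> Prop) :
  (exists i, i \in s /\ Q i) ->
  exists e, [/\ e \in s, Q e & forall i, i \in s -> Q i -> (i <= e)%O].
Proof.
elim: s => [[i []//]|a s IH [i [ia Qi]]].
have [[j [js Qj]]|none] := pselect (exists j, j \in s /\ Q j); last first.
  have ai : i = a.
    move: ia; rewrite inE => /orP[/eqP //|is_].
    by case: none; exists i.
  exists a; rewrite mem_head -{1}ai; split=> // k.
  rewrite inE => /orP[/eqP -> //|ks Qk]; by case: none; exists k.
have [|e [es Qe emax]] := IH; first by exists j.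
have [[Qa ea]|nea] := pselect (Q a /\ (e < a)%O).
  exists a; rewrite mem_head; split=> // k.
  rewrite inE => /orP[/eqP -> //|ks Qk]; exact: le_trans (emax k ks Qk) (ltW ea).
exists e; rewrite inE es orbT; split=> // k.
rewrite inE => /orP[/eqP -> Qa|]; last exact: emax.
by rewrite leNgt; apply/negP => ea; apply: nea.
Qed.

(** * Prime annihilators in graded modules *)

Section AssociatedPrimes.
Variables (R : comNzRingType) (V : lmodType R).
Variables (GR : nat -> {pred R}) (GV : int -> {pred V}).
Variables (cR : nat -> R -> R) (cV : int -> V -> V).
Hypothesis GVz : forall i, zmod_closed (GV i).
Hypotheses (cRP : components GR cR) (cVP : components GV cV).
Hypothesis act : forall (j : nat) (i : int) a v,
  a \in GR j -> v \in GV i -> a *: v \in GV (j%:Z + i).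

(* Were a in J with a component outside J, the largest such component would
   kill the top component of x and so shorten x without changing its
   annihilator. *)
Lemma annihilator_hom (J : R -> Prop) (x : V) : primes J ->
  (forall r, J r <-> r *: x = 0) -> homR cR J.
Proof.
move=> [iJ nJ1 JJ].
have shift_inj j : injective (fun i : int => j%:Z + i) by move=> i i' /addrI.
have actE (j : nat) a v (k : int) : a \in GR j -> cV k (a *: v) = a *: cV (k - j%:Z) v.
  move=> aj; rewrite -(cmp_act GVz cVP shift_inj act _ _ aj).
  by rewrite addrC subrK.
have [s [us s0 _]] := cmp_support cVP x.
have [n] := ubnP (size s); elim: n s x us s0 => // n IH s x us s0 ns Jx.
apply: contrapT => nh.
have [a [k [Ja nJk]]] : exists a k, J a /\ ~ J (cR k a).
  apply: contrapT => H; apply: nh => k a Ja; apply: contrapT => nJk.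
  by apply: H; exists a, k.
have [t [ut t0 aE]] := cmp_support cRP a.
have [|d [dt nJd dmax]] := @seq_max _ nat t (fun j => ~ J (cR j a)).
  exists k; split=> //; apply: contrapT => /negP /t0 E.
  by apply: nJk; rewrite E; apply: ideal0.
have [|e [es nxe emax]] := @seq_max _ int s (fun i => cV i x <> 0).
  apply: contrapT => H; apply: nJ1; apply/Jx; rewrite scale1r.
  have [s' [us' s0' ->]] := cmp_support cVP x.
  apply: big1_seq => i _; apply: contrapT => ni; apply: H; exists i; split=> //.
  by apply: contrapT => /negP /s0.
have e0 i : e < i -> cV i x = 0.
  move=> ei; apply: contrapT => ni; have [si|/s0 //] := boolP (i \in s).
  by have := emax i si ni; rewrite leNgt ei.
(* The components above [d] are in [J], so they can be removed; the top component of a' x is then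
   the product of the components of degrees [d] and [e]. *)
pose a' := \sum_(j <- t | (j <= d)%N) cR j a.
have Ja' : J a'.
  have -> : a' = a - \sum_(j <- t | ~~ (j <= d)%N) cR j a.
    by rewrite {1}aE (bigID (fun j => (j <= d)%N)) /= addrK.
  apply: idealB => //; rewrite -big_filter; apply: ideal_sum => // j.
  rewrite mem_filter -ltnNge => /andP[dj jt]; apply: contrapT => nJj.
  by have := dmax j jt nJj; rewrite leEnat leqNgt dj.
have ade0 : cR d a *: cV e x = 0.
  have := congr1 (cV (d%:Z + e)) ((Jx a').1 Ja').
  rewrite (cmp0 GVz cVP) scaler_suml (cmp_sum GVz cVP).
  rewrite -big_filter (big_rem d) /=; last by rewrite mem_filter leqnn.
  rewrite (actE d _ _ _ (cmp_mem cRP d a)) [d%:Z + e]addrC addrK big1_seq ?addr0 // => j.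
  rewrite mem_rem_uniq ?filter_uniq // inE mem_filter => /andP[_ /and3P[jd /= jle _]].
  rewrite (actE j _ _ _ (cmp_mem cRP j a)) e0 ?scaler0 //.
  rewrite -subr_gt0; have -> : e + d%:Z - j%:Z - e = d%:Z - j%:Z by ring.
  by rewrite subr_gt0 ltz_nat ltn_neqAle jd.
(* The new element has lost its component coming from degree [e], and its annihilator is still [J]
   because [J] is prime and does not contain [cR d a]. *)
apply: nh; apply: (IH [seq d%:Z + i | i <- rem e s] (cR d a *: x)).
- by rewrite map_inj_uniq; [apply: rem_uniq|apply: shift_inj].
- move=> i ni; rewrite (actE d _ _ _ (cmp_mem cRP d a)).
  have [ie|ne] := eqVneq (i - d%:Z) e; first by rewrite ie.
  rewrite s0 ?scaler0 //; apply: contra ni => si; apply/mapP.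
  exists (i - d%:Z); last by rewrite addrC subrK.
  by rewrite mem_rem_uniq // inE ne.
- by rewrite size_map size_rem //; case: (s) es ns.
move=> r; rewrite scalerA -Jx; split=> [Jr|/JJ[]//].
exact: idealMr.
Qed.
End AssociatedPrimes.

Lemma pfilt_killed_outside (R : comNzRingType) (V : lmodType R)
    (P : nat -> R -> Prop) L (A N : V -> Prop) (p : R -> Prop) :
  subm A -> primes p -> (forall j, j \in L -> ~ sub (P j) p) ->
  pfilt P L A N -> exists t, ~ p t /\ forall v, N v -> A (t *: v).
Proof.
move=> sA pp; elim: L A sA => [|i L IH] A sA Lp /=.
  by move=> <-; exists 1; split=> [|v]; [case: pp|rewrite scale1r].
move=> [e [eP /IH[]]]; first exact: (spanm_subm [:: e]).
  by move=> j jL; apply: Lp; rewrite inE jL orbT.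
move=> t [nt tN]; move/existsNP: (Lp i (mem_head _ _)) => [t' /not_implyP[Pt nt']].
exists (t' * t); split; first exact: primeN.
move=> v /tN[r [u [Au E]]]; rewrite -scalerA E.
have -> : t' *: (u + r *: e) = t' *: u + r *: (t' *: e) by mring.
by apply: submD => //; apply: submZ => //; apply/eP.
Qed.

(* The first prime of the filtration contained in P i is P i itself, and it is
   the annihilator of an element. *)
Lemma pretty_clean_ann (R : comNzRingType) (V : lmodType R) r
    (F : nat -> submodClosed V) (P : nat -> ideal R) i :
  pretty_clean_filtration r F P -> (i < r)%N ->
  exists x : V, forall a, seti (P i) a <-> a *: x = 0.
Proof.
move=> pcF ir; pose p j := seti (P j).
have ex0 : exists j, `[< sub (p j) (p i) >].
  by exists i; apply/asboolP.
case: (ex_minnP ex0) => j /asboolP ji jmin.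
have jle : (j <= i)%N by apply: jmin; apply/asboolP.
have jr : (j < r)%N by apply: leq_ltn_trans ir.
have Eji : p j = p i.
  have [<-//|nij] := eqVneq j i.
  have lt : (j < i)%N by rewrite ltn_neqAle nij.
  by apply: sub_eq => // x; rewrite /p /seti (pcF.2 j i lt ir ji).
have pj : primes (p j) by apply/primesP; have [_ /(_ j jr)[]] := pcF.1.
have : pfilt p (iota 0 r) zerom (@fullm R V) := pfilt_prime pcF.1.
have -> : r = (j + (r - j.+1).+1)%N by rewrite addnS -addSn subnKC.
rewrite iotaD add0n => /pfilt_cat[N [p1 /= [e [eP _]]]].
(* By minimality of [j] no earlier prime lies inside [p j], so some [t] outside [p j] kills the
   earlier part [N]; multiplying the lift [e] by [t] gives annihilator exactly [p j]. *)
have [|t [nt tN]] := pfilt_killed_outside (@zerom_subm R V) pj _ p1.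
  move=> k; rewrite mem_iota add0n /= => kj kpj.
  have : (j <= k)%N by apply: jmin; apply/asboolP; rewrite -Eji.
  by rewrite leqNgt kj.
exists (t *: e) => a; rewrite -/(p i a) -Eji; split.
  by move/eP/tN; rewrite scalerA mulrC -scalerA.
rewrite scalerA => E; have [sN _] := pfilt_sub (@zerom_subm R V) p1.
have : p j (a * t) by apply/eP; rewrite E; apply: subm0.
by case: pj => _ _ PP /PP[].
Qed.

(** * Standard graded algebras as a local class *)

Section GradedRing.
Variables (K : fieldType) (R : comAlgType K).
Variables (G : nat -> submodClosed (R : lmodType K)) (m : ideal R).
Hypotheses (sG : standard_graded G) (mI : is_irrelevant G m).

Let GR : nat -> {pred R} := fun i => G i.
Variable cR : nat -> R -> R.
Hypothesis cRP : components GR cR.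

Lemma GR_zmod j : zmod_closed (GR j).
Proof.
split=> [|x y xG yG]; first exact: rpred0.
by rewrite -(scaleN1r (y : (R : lmodType K))); apply: rpredD => //; apply: rpredZ.
Qed.

Lemma cR_act j i (a v : R) : a \in GR j -> v \in GR i -> a * v \in GR (j + i)%N.
Proof. by case: sG => _ H _ _ _; apply: H. Qed.

Lemma irrelevantP (x : R) : seti m x <-> cR 0%N x = 0.
Proof.
split=> [/mI[s [c [s0 us cG ->]]]|x0].
  by rewrite (cmp_unique cRP us cG) /restrict (negbTE s0).
apply/mI; have [s [us s0 xE]] := cmp_support cRP x.
exists [seq i <- s | i != 0%N], (cR^~ x); split.
- by rewrite mem_filter.
- exact: filter_uniq.
- by move=> i; apply: (cmp_mem cRP).
rewrite {1}xE big_filter [RHS]big_mkcond; apply: eq_bigr => i _ /=.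
by case: eqP => //= ->.
Qed.

Lemma cR_mul k j (a v : R) : a \in GR j ->
  cR (j + k)%N (a * v) = a * cR k v.
Proof.
move=> aj.
exact: (@cmp_act R R^o nat GR GR addn cR GR_zmod cRP (fun j => @addnI j) cR_act).
Qed.

Lemma deg0_domain (a b : R) : a \in GR 0%N -> b \in GR 0%N -> a * b = 0 ->
  a = 0 \/ b = 0.
Proof.
case: sG => _ _ G0 _ _ /G0[x ->] /G0[y ->].
rewrite -scalerAl mul1r scalerA => /eqP.
by rewrite scaler_eq0 oner_eq0 orbF mulf_eq0 => /orP[]/eqP ->;
  rewrite scale0r; [left|right].
Qed.

Lemma one_deg0 : (1 : R) \in GR 0%N.
Proof. by case: sG => _ _ G0 _ _; apply/G0; exists 1; rewrite scale1r. Qed.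

(** Degrees are nonnegative, so the component of degree 0 is multiplicative; it takes values in the
    field [K]. *)
Lemma irrelevant_prime : primes (seti m).
Proof.
split; first exact: seti_ideal.
  rewrite irrelevantP (cmp_homog GR_zmod cRP _ one_deg0) eqxx.
  by move/eqP; rewrite oner_eq0.
move=> a b; rewrite !irrelevantP => ab.
apply: deg0_domain; try exact: (cmp_mem cRP).
have [s [us s0 aE]] := cmp_support cRP a; rewrite -{}ab {2}aE mulr_suml.
rewrite (cmp_sum GR_zmod cRP).
have F i : cR 0%N (cR i a * b) = if i == 0%N then cR 0%N a * cR 0%N b else 0.
  case: eqP => [->|/eqP]; first by rewrite -[in LHS](addn0 0%N) cR_mul ?(cmp_mem cRP).
  rewrite -lt0n => i0; have [t [ut t0 ->]] := cmp_support cRP b.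
  rewrite mulr_sumr (cmp_sum GR_zmod cRP) big1 // => k _.
  rewrite (cmp_homog GR_zmod cRP _ (cR_act (cmp_mem cRP i a) (cmp_mem cRP k b))).
  by case: eqP => // E; have := ltn_addr k i0; rewrite -E.
under eq_bigr do rewrite F.
rewrite -big_mkcond /=; have [s0i|/s0 ->] := boolP (0%N \in s).
  rewrite (big_rem 0%N) //= big1_seq ?addr0 // => k /andP[/eqP ->].
  by rewrite mem_rem_uniqF.
by rewrite mul0r big1.
Qed.

Definition hom_ideal (I : R -> Prop) := is_ideal I /\ homR cR I.

Lemma graded_local_class :
  local_class (seti m) hom_ideal (fun s => exists j, s \in GR j).
Proof.
have [_ _ G0 _ _] := sG.
split=> [I []//|I [iI hI] nI1|I J [iI hI] [iJ hJ]|I s [iI hI] [j sj]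
        |I J [iI hI] [iJ hJ]|I u [iI hI] [j uj]].
(* A nonzero component of degree 0 is a unit, and a graded ideal containing [x] contains it. *)
- move=> x Ix; apply/irrelevantP; have /G0[a aE] := cmp_mem cRP 0%N x.
  have [a0|a0] := eqVneq a 0; first by rewrite aE a0 scale0r.
  case: nI1; have -> : (1 : R) = (a^-1)%:A * cR 0%N x.
    by rewrite aE -scalerAl mul1r scalerA mulVf // scale1r.
  by apply: idealM => //; apply: hI.
- move=> nJI; apply: contrapT => H; apply: nJI => x Jx.
  have [s [us s0 ->]] := cmp_support cRP x; apply: (ideal_sum iI) => k _.
  apply: contrapT => nIk; apply: H; exists (cR k x); split=> //.
    by exists k; apply: (cmp_mem cRP).
  exact: hJ.
- split; first exact: add_gen_ideal.
  move=> k _ [r [u [Iu ->]]]; rewrite (cmpD GR_zmod cRP) [r * s]mulrC.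
  have [w ->] := @cmp_act_ex R R^o nat GR GR addn cR GR_zmod cRP cR_act j s r k sj.
  by exists w, (cR k u); split; [exact: hI|rewrite [s *: w]mulrC].
- split; first exact: (@colon_ideal R I J iI).
  move=> k x xJ p Jp; rewrite mulrC.
  have hc := @hom_colon R R^o nat GR GR addn cR cR GR_zmod cRP cRP
    (fun j => @addnI j) cR_act J I iI hJ hI.
  by apply: (hc k x) => // q Jq; rewrite [_ *: _]mulrC; apply: xJ.
- split; first exact: (@colon_elt_ideal R I u iI).
  move=> k x Ix; rewrite mulrC -(cR_mul _ _ uj); apply: hI.
  by rewrite mulrC.
Qed.
End GradedRing.

Lemma colon_subm (R : comNzRingType) (V : lmodType R) (I : R -> Prop)
  (A : V -> Prop) : subm A -> subm (colon I A).
Proof.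
move=> sA; split=> [p _|a x y Ax Ay p Ip]; first by rewrite scaler0; apply: subm0.
have -> : p *: (a *: x + y) = a *: (p *: x) + p *: y by mring.
by apply: submP => //; [exact: Ax|exact: Ay].
Qed.

(** * Gradedness of the constructed submodules *)

Section GradedModule.
Variables (K : fieldType) (R : comAlgType K).
Variables (G : nat -> submodClosed (R : lmodType K)) (m : ideal R).
Hypotheses (nR : noethR R) (sG : standard_graded G) (mI : is_irrelevant G m).
Variables (M : lmodType R) (MG : int -> zmodClosed M) (r : nat)
  (F : nat -> submodClosed M) (P : nat -> ideal R).
Hypotheses (gM : graded_module G MG) (pcF : pretty_clean_filtration r F P).
Variables (cR : nat -> R -> R) (cM : int -> M -> M).
Hypotheses (cRP : components (fun i => G i : {pred R}) cR)
  (cMP : components (fun i => MG i : {pred M}) cM).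

Lemma MG_zmod i : zmod_closed (MG i : {pred M}).
Proof. by split=> [|x y xM yM]; [exact: rpred0|exact: rpredB]. Qed.

Lemma step_hom i : (i < r)%N -> hom_ideal cR (seti (P i)).
Proof.
move=> ir; split; first exact: seti_ideal.
have [x xP] := pretty_clean_ann pcF ir.
apply: (annihilator_hom MG_zmod cRP cMP _ _ xP).
  by case: gM => _ H j k a v; apply: H.
by apply/primesP; have [_ /(_ i ir)[]] := pcF.1.
Qed.

Lemma kill_hom (L : seq nat) (A : M -> Prop) : (forall i, i \in L -> (i < r)%N) ->
  subm A -> homV cM A -> homV cM (kill (fun i => seti (P i)) L A).
Proof.
elim: L A => //= i L IH A Lr sA hA; apply: IH.
- by move=> j jL; apply: Lr; rewrite inE jL orbT.
- exact: colon_subm.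
have [_ hP] := step_hom (Lr i (mem_head _ _)).
apply: (@hom_colon R M int (fun i => G i : {pred R}) (fun i => MG i : {pred M})
  (fun j k => j%:Z + k) cR cM MG_zmod cRP cMP (fun j => @addrI _ j%:Z)) => //.
by case: gM => _ H j k a v; apply: H.
Qed.

Lemma kill_homogeneous (L : seq nat) (N : submodClosed M) :
  (forall i, i \in L -> (i < r)%N) ->
  (forall v, v \in N <-> kill (fun i => seti (P i)) L zerom v) ->
  homogeneous MG N.
Proof.
move=> Lr NP s c us cG /NP kc i si; apply/NP.
have h0 : homV cM zerom by move=> j _ ->; apply: (cmp0 MG_zmod cMP).
have := kill_hom Lr (@zerom_subm R M) h0 i kc.
by rewrite (cmp_unique cMP us cG) /restrict si.
Qed.
End GradedModule.

Theorem theorem4p1 :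
  (forall (R : comNzRingType) (m : ideal R),
     noetherian R -> is_local m -> CM m R^o ->
     (exists omega : lmodType R, is_canonical m omega) ->
   forall (M : lmodType R) (r : nat)
     (F : nat -> submodClosed M) (P : nat -> ideal R),
     fin_gen M -> pretty_clean_filtration r F P ->
     (forall i, (i < r)%N -> CM m (quotmod (P i))) ->
     seq_CM m M /\
     ((forall i, (i < r)%N -> krull_dim (quotmod (P i)) = krull_dim M) ->
      clean M /\ CM m M))
  /\
  (forall (K : fieldType) (R : comAlgType K)
     (G : nat -> submodClosed (R : lmodType K)) (m : ideal R),
     noetherian R -> standard_graded G -> is_irrelevant G m -> CM m R^o ->
     (exists (omega : lmodType R) (omegaG : int -> zmodClosed omega),
        is_graded_canonical G m omegaG) ->
   forall (M : lmodType R) (MG : int -> zmodClosed M) (r : nat)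
     (F : nat -> submodClosed M) (P : nat -> ideal R),
     fin_gen M -> graded_module G MG -> pretty_clean_filtration r F P ->
     (forall i, (i < r)%N -> CM m (quotmod (P i))) ->
     graded_seq_CM m MG /\
     ((forall i, (i < r)%N -> krull_dim (quotmod (P i)) = krull_dim M) ->
      clean M /\ CM m M)).
Proof.
split.
  move=> R m nR lm _ _ M r F P _ pcF cmP.
  have nR' := noetherian_noethR nR.
  have pm : primes (seti m) by apply: maximal_prime; case: lm.
  have lc := ideals_local_class nR' lm.
  have HP i : (i < r)%N -> is_ideal (seti (P i)) by move=> _; apply: seti_ideal.
  split; last exact: (class_clean_CM nR' pm lc pcF cmP HP).
  exact: (class_seq_CM nR' pm lc pcF cmP HP).
move=> K R G m nR sG mI _ _ M MG r F P _ gM pcF cmP.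
have nR' := noetherian_noethR nR.
have [cR cRP] := components_exist (GR_zmod G) (let: And5 H _ _ _ _ := sG in H).
have [cM cMP] := components_exist (MG_zmod MG) gM.1.
have pm := irrelevant_prime sG mI cRP.
have lc := graded_local_class sG mI cRP.
have HP := step_hom gM pcF cRP cMP.
split; last exact: (class_clean_CM nR' pm lc pcF cmP HP).
apply: (class_seq_CM nR' pm lc pcF cmP HP) => L N.
exact: (kill_homogeneous gM pcF cRP cMP).
Qed.
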